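(* Let $\mathcal{P}$ be a hereditary property of posets. Then one of the following assertions holds. (a) There is $N \in \mathbb{N}$ such that $|\mathcal{P}^n| = 1$ for every $n \geq N$. (b) $|\mathcal{P}^n|$ is (eventually) a polynomial: there exist $K \in \mathbb{N}$ and integers $a_0, \ldots, a_K$ with $a_K \neq 0$ such that $$|\mathcal{P}^n| = \sum_{i=0}^K a_i \binom{n}{i}$$ for all sufficiently large $n$. Moreover, $$|\mathcal{P}^n| \geq \sum_{i=0}^K \binom{n}{i}$$ for all $n \geq 2K+1$. In particular, $|\mathcal{P}^n| \geq n+1$ for every $n \geq 3$. (c) $|\mathcal{P}^n| \geq 2^n - 1$ for every $n \geq 6$. Moreover, each of the lower bounds is best possible: for each $K \in \mathbb{N}$ there is a hereditary property of posets $\mathcal{P}$ with $|\mathcal{P}^n| = \sum_{i=0}^K \binom{n}{i}$ for all $n \geq 2K+1$ (in particular, for $K=1$, one with $|\mathcal{P}^n| = n+1$ for every $n \geq 3$), and there is a hereditary property of posets $\mathcal{P}$ with $|\mathcal{P}^n| = 2^n - 1$ for every $n \geq 6$.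
   Context: All posets are finite and $\mathbb{N} = \{1,2,3,\ldots\}$. A hereditary property of posets is a collection $\mathcal{P}$ of finite posets that is closed under isomorphism, closed under taking induced subposets, and contains arbitrarily large posets. $\mathcal{P}^n$ denotes the collection of distinct labelled posets in $\mathcal{P}$ with $n$ elements labelled $1,\ldots,n$; equivalently, $|\mathcal{P}^n|$ is the number of partial orders on the ground set $\{1,\ldots,n\}$ that belong to $\mathcal{P}$. *)

(* Defs.v *)
From HB Require Import structures.
From mathcomp Require Import all_boot all_order all_algebra.
From mathcomp Require Import boolp.

Set Implicit Arguments.
Unset Strict Implicit.
Unset Printing Implicit Defensive.

Definition poset_collection := forall d : Order.disp_t, finPOrderType d -> Prop.

Definition poset_isomorphic (d d' : Order.disp_t)
    (T : finPOrderType d) (U : finPOrderType d') : Prop :=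
  exists2 f : T -> U, bijective f & {mono f : x y / (x <= y)%O}.

Definition induced_subposet (d : Order.disp_t) (T : finPOrderType d)
  (A : {set T}) := {x : T | x \in A}.

HB.instance Definition _ d (T : finPOrderType d) (A : {set T}) :=
  SubFinite.on (induced_subposet A).
HB.instance Definition _ d (T : finPOrderType d) (A : {set T}) :=
  [SubChoice_isSubPOrder of induced_subposet A by <: with d].

Definition hereditary_property (P : poset_collection) : Prop :=
  [/\ forall d d' (T : finPOrderType d) (U : finPOrderType d'),
        poset_isomorphic T U -> P d T -> P d' U,
      forall d (T : finPOrderType d) (A : {set T}),
        P d T -> P d (induced_subposet A)
    & forall m : nat, exists d (T : finPOrderType d), m <= #|T| /\ P d T].

(* The ground set {1, ..., n} is represented by 'I_n, and a binary relation
   on it by its set of pairs; (i, j) \in r is read "i is below or equal to j". *)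
Definition pair_rel n (r : {set 'I_n * 'I_n}) : rel 'I_n :=
  fun i j => (i, j) \in r.

Definition partial_order n (r : {set 'I_n * 'I_n}) : Prop :=
  [/\ reflexive (pair_rel r), antisymmetric (pair_rel r)
    & transitive (pair_rel r)].

(* The ordinals carry their usual total order in the library, so the poset
   ('I_n, r) lives on an alias of 'I_n. *)
Definition labelled_poset n (r : {set 'I_n * 'I_n}) of partial_order r := 'I_n.

Fact labelled_poset_display : Order.disp_t. Proof. exact: Order.Disp tt tt. Qed.

Section LabelledPoset.
Variables (n : nat) (r : {set 'I_n * 'I_n}) (ord_r : partial_order r).

HB.instance Definition _ := Finite.on (labelled_poset ord_r).

Let le_refl : reflexive (pair_rel r). Proof. by case: ord_r. Qed.
Let le_anti : antisymmetric (pair_rel r). Proof. by case: ord_r. Qed.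
Let le_trans : transitive (pair_rel r). Proof. by case: ord_r. Qed.

HB.instance Definition _ :=
  Order.Le_isPOrder.Build labelled_poset_display (labelled_poset ord_r)
    le_refl le_anti le_trans.
End LabelledPoset.

Definition labelled_members (P : poset_collection) n
    : {set {set 'I_n * 'I_n}} :=
  [set r | `[< exists ord_r : partial_order r,
                 P labelled_poset_display (labelled_poset ord_r) >]].

Definition speed (P : poset_collection) (n : nat) : nat :=
  #|labelled_members P n|.

(* Main.v *)
(* A hereditary property either realizes arbitrarily large chains, complete
   bipartite posets, stars with isolated points, dual stars or induced
   matchings, each of which alone yields 2^n - 1 labelled posets, or for some m
   it excludes all five at size m.  In the latter case take a maximum antichain
   A: every element outside A is comparable to few or to almost all elements of
   A, and there are boundedly many of both kinds, so all but M elements are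
   mutually incomparable twins.  The complement of the big twin class is the
   core.  The number of labelled posets with a given core of size i is
   nonincreasing in n, hence eventually a constant c_i, and the speed is
   eventually the sum of the c_i 'C(n, i).  For the lower bound, some deletion
   of a core element shrinks the core by exactly one unless the core is an
   induced matching; in that case swapping a matched pair shows that there are
   two posets per core of size K, and 'C(n, K - 1) <= 'C(n, K) pays for the
   missing core size K - 1. *)
Require Import Defs.
From HB Require Import structures.
From mathcomp Require Import all_boot all_order all_algebra all_fingroup.
From mathcomp Require Import boolp zify.

Set Implicit Arguments.
Unset Strict Implicit.
Unset Printing Implicit Defensive.

(** Twin classes are used because of a rigidity: a poset with core [S] is determined by its
    restriction to [S] together with a single clone, so thinning out the clones is injective as long
    as they stay in the majority. The threshold [n > 2K] comes from the uniqueness of the core: two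
    twin classes that each hold more than half of the elements must meet, hence coincide. The
    obstacle in the lower bound is that deleting a core element may turn other core elements into
    clones. Consider one comparable pair with isolated points added: deleting either end of the pair
    leaves an antichain, so cores of sizes 0 and 2 occur but none of size 1. What saves the bound
    there is that the pair has two orientations, and 2 C(n, 2) is at least C(n, 1) + C(n, 2) for n
    >= 3. *)

Definition is_order (V : finType) (R : rel V) : Prop :=
  [/\ reflexive R, antisymmetric R & transitive R].

Definition embeds (V W : finType) (S : rel V) (R : rel W) : Prop :=
  exists2 f : V -> W, injective f & forall x y, S x y = R (f x) (f y).

Lemma embedsI (V W : finType) (S : rel V) (R : rel W) (f : V -> W) :
  antisymmetric S -> reflexive R -> (forall x y, S x y = R (f x) (f y)) ->
  embeds S R.
Proof.
move=> Santi Rrefl SR; exists f => // x y fxy.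
by apply: Santi; rewrite !SR fxy Rrefl.
Qed.

Lemma embeds_order (V W : finType) (S : rel V) (R : rel W) :
  embeds S R -> is_order R -> is_order S.
Proof.
move=> [f f_inj SR] [Rr Ra Rt]; split.
- by move=> x; rewrite SR.
- by move=> x y; rewrite !SR => /Ra /f_inj.
- by move=> y x z; rewrite !SR; apply: Rt.
Qed.

Lemma embeds_flip (V W : finType) (S : rel V) (R : rel W) :
  embeds S R -> embeds (fun x y => S y x) (fun x y => R y x).
Proof. by move=> [f f_inj SR]; exists f => // x y; rewrite SR. Qed.

(** * Relations realized in a hereditary property *)

Section Realized.
Variable P : poset_collection.

(** Phrased through embeddings so that heredity becomes composition of maps, and a deletion or
    relabelling needs no poset instance of its own. *)
Definition realized (V : finType) (R : rel V) : Prop :=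
  exists (d : Order.disp_t) (T : finPOrderType d),
    P T /\ embeds R (fun x y : T => (x <= y)%O).

Lemma realized_order (V : finType) (R : rel V) : realized R -> is_order R.
Proof.
move=> [d [T [_ emb]]]; apply: embeds_order emb _; split.
- exact: Order.POrderTheory.lexx.
- exact: Order.POrderTheory.le_anti.
- exact: Order.POrderTheory.le_trans.
Qed.

Lemma realized_embeds (V W : finType) (S : rel V) (R : rel W) :
  embeds S R -> realized R -> realized S.
Proof.
move=> [f f_inj SR] [d [T [PT [g g_inj Rg]]]]; exists d, T; split=> //.
by exists (g \o f) => [|x y]; [apply: inj_comp | rewrite SR Rg].
Qed.

Hypothesis Pher : hereditary_property P.

(** The image of an embedding is an induced subposet of a member, and the embedding is an
    isomorphism onto it; the two closure axioms then lead back to the labels. *)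
Lemma labelled_membersP n (r : {set 'I_n * 'I_n}) :
  r \in labelled_members P n <-> realized (pair_rel r).
Proof.
have [Piso Psub _] := Pher; rewrite inE; split.
  move=> /asboolP[ord_r Pr]; exists labelled_poset_display, (labelled_poset ord_r).
  by split=> //; exists id.
move=> real_r; apply/asboolP; have ord_r : partial_order r := realized_order real_r.
exists ord_r; have [d [T [PT [f f_inj rf]]]] := real_r.
apply: (Piso _ _ _ _ _ (Psub _ _ (f @: [set: 'I_n]) PT)).
have fP i : f i \in f @: [set: 'I_n] by apply: imset_f.
pose g i : induced_subposet (f @: [set: 'I_n]) := exist _ (f i) (fP i).
have g_inj : injective g by move=> i j /(congr1 val)/= /f_inj.
have card_eq : #|{: induced_subposet (f @: [set: 'I_n])}| = #|'I_n|.
  by rewrite card_sig card_imset // cardsT.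
have [h hg gh] : bijective g by apply: inj_card_bij; rewrite ?card_eq.
exists h => [|x y]; first by exists g.
by by rewrite -[in RHS](gh x) -[in RHS](gh y); exact: rf.
Qed.

Lemma realized_large m : exists (V : finType) (R : rel V), m <= #|V| /\ realized R.
Proof.
have [_ _ /(_ m)[d [T [mT PT]]]] := Pher.
by exists T, (fun x y : T => (x <= y)%O); split=> //; exists d, T; split=> //; exists id.
Qed.

End Realized.

Definition relset n (R : rel 'I_n) : {set 'I_n * 'I_n} := [set p | R p.1 p.2].

Lemma pair_relset n (R : rel 'I_n) i j : pair_rel (relset R) i j = R i j.
Proof. by rewrite /pair_rel inE. Qed.

Lemma relset_members P n (R : rel 'I_n) :
  hereditary_property P -> realized P R -> relset R \in labelled_members P n.
Proof.
move=> Pher real_R; apply/(labelled_membersP Pher); apply: realized_embeds real_R.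
by exists id => // i j; rewrite pair_relset.
Qed.

(** * Unavoidable configurations *)

Definition chain_rel m : rel 'I_m := fun i j => i <= j.

Definition biclique_rel m : rel ('I_m + 'I_m) := fun x y =>
  match x, y with inl _, inr _ => true | _, _ => x == y end.

(** The centre [None] lies below the [inl] points, and the [inr] points are isolated. The isolated
    points matter: bare stars and their subposets give only linearly many labelled posets. *)
Definition star_rel m : rel (option ('I_m + 'I_m)) := fun x y =>
  match x, y with None, Some (inl _) => true | _, _ => x == y end.

Definition matching_rel m : rel ('I_m + 'I_m) := fun x y =>
  match x, y with inl i, inr j => i == j | _, _ => x == y end.

Lemma biclique_anti m : antisymmetric (@biclique_rel m).
Proof. by case=> [i|i] [j|j] //= /andP[] // /eqP. Qed.

Lemma star_anti m : antisymmetric (@star_rel m).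
Proof. by case=> [[i|i]|] [[j|j]|] //= /andP[] // /eqP. Qed.

Lemma matching_anti m : antisymmetric (@matching_rel m).
Proof. by case=> [i|i] [j|j] //= /andP[] //; try by [move=> /eqP | move=> _ /eqP]. Qed.

Definition antichain (V : finType) (R : rel V) (A : {set V}) : Prop :=
  {in A &, forall x y, R x y = (x == y)}.

Lemma antichainS (V : finType) (R : rel V) (A B : {set V}) :
  A \subset B -> antichain R B -> antichain R A.
Proof. by move=> /subsetP sAB antiB x y Ax Ay; apply: antiB; apply: sAB. Qed.

Lemma antichain_flip (V : finType) (R : rel V) (A : {set V}) :
  antichain R A -> antichain (fun x y => R y x) A.
Proof. by move=> antiA x y Ax Ay; rewrite antiA // eq_sym. Qed.

Lemma ord_inj_in_set (V : finType) (A : {set V}) m :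
  m <= #|A| -> exists2 f : 'I_m -> V, injective f & forall i, f i \in A.
Proof.
move=> mA; exists (fun i => enum_val (widen_ord mA i)) => [i j /enum_val_inj|i].
  by move=> /(congr1 val)/= /val_inj.
exact: enum_valP.
Qed.

Lemma leq_card_bigcup (I V : finType) (D : {set I}) (F : I -> {set V}) b :
  (forall i, i \in D -> #|F i| <= b) -> #|\bigcup_(i in D) F i| <= #|D| * b.
Proof.
move=> Fb; rewrite -sum_nat_const.
apply: (big_ind2 (fun (X : {set V}) n => #|X| <= n)) => //; first by rewrite cards0.
by move=> X k Y l Xk Yl; rewrite (leq_trans (leq_card_setU _ _)) // leq_add.
Qed.

Section OrderFacts.
Variables (V : finType) (R : rel V).
Hypothesis ordR : is_order R.

Lemma embeds_biclique m (A B : {set V}) :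
  m <= #|A| -> m <= #|B| -> antichain R A -> antichain R B ->
  {in A & B, forall a b, R a b && ~~ R b a} -> embeds (@biclique_rel m) R.
Proof.
have [Rr Ra Rt] := ordR.
move=> /ord_inj_in_set[f f_inj fA] /ord_inj_in_set[g g_inj gB] antiA antiB RAB.
pose h (x : 'I_m + 'I_m) := match x with inl i => f i | inr i => g i end.
apply: (@embedsI _ _ _ _ h) => //; first exact: biclique_anti.
have fE i j : R (f i) (f j) = (i == j) by rewrite antiA // (inj_eq f_inj).
have gE i j : R (g i) (g j) = (i == j) by rewrite antiB // (inj_eq g_inj).
move=> [i|i] [j|j] /=; rewrite ?fE ?gE //.
- by case/andP: (RAB _ _ (fA i) (gB j)).
- by case/andP: (RAB _ _ (fA j) (gB i)) => _ /negPf ->.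
Qed.

Lemma embeds_star m z (A B : {set V}) :
  m <= #|A| -> m <= #|B| -> antichain R (A :|: B) -> [disjoint A & B] ->
  {in A, forall a, R z a && ~~ R a z} ->
  {in B, forall b, ~~ R z b && ~~ R b z} -> embeds (@star_rel m) R.
Proof.
have [Rr Ra Rt] := ordR.
move=> /ord_inj_in_set[f f_inj fA] /ord_inj_in_set[g g_inj gB] antiAB dAB RA RB.
pose h (x : option ('I_m + 'I_m)) :=
  match x with Some (inl i) => f i | Some (inr i) => g i | None => z end.
have fAB i : f i \in A :|: B by rewrite inE fA.
have gAB i : g i \in A :|: B by rewrite inE gB orbT.
have fg i j : (f i == g j) = false.
  by apply/eqP => fgE; have := disjointFr dAB (fA i); rewrite fgE gB.
apply: (@embedsI _ _ _ _ h) => //; first exact: star_anti.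
have gf i j : (g i == f j) = false by rewrite eq_sym fg.
have RE x y : x \in A :|: B -> y \in A :|: B -> R x y = (x == y) by apply: antiAB.
move=> [[i|i]|] [[j|j]|] /=; rewrite ?Rr // ?[X in _ = X](RE _ _ (fAB _) (fAB _))
  ?[X in _ = X](RE _ _ (fAB _) (gAB _)) ?[X in _ = X](RE _ _ (gAB _) (fAB _))
  ?[X in _ = X](RE _ _ (gAB _) (gAB _)) ?fg ?gf ?(inj_eq f_inj) ?(inj_eq g_inj) //.
- by case/andP: (RA _ (fA i)) => _ /negPf ->.
- by case/andP: (RB _ (gB i)) => _ /negPf ->.
- by case/andP: (RA _ (fA j)) => ->.
- by case/andP: (RB _ (gB j)) => /negPf ->.
Qed.

Lemma embeds_matching m (A B : {set V}) (p : V -> V) :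
  m <= #|A| -> antichain R A -> antichain R B ->
  (forall a, a \in A -> p a \in B) ->
  {in A &, forall a a', R (p a) a' = (a == a')} ->
  {in A & B, forall a b, ~~ R a b} ->
  embeds (@matching_rel m) R.
Proof.
have [Rr Ra Rt] := ordR.
move=> /ord_inj_in_set[f f_inj fA] antiA antiB pB Rp RAB.
pose h (x : 'I_m + 'I_m) := match x with inl i => p (f i) | inr i => f i end.
apply: (@embedsI _ _ _ _ h) => //; first exact: matching_anti.
have fE i j : R (f i) (f j) = (i == j) by rewrite antiA // (inj_eq f_inj).
have pE i j : R (p (f i)) (f j) = (i == j) by rewrite Rp // (inj_eq f_inj).
move=> [i|i] [j|j] /=; rewrite ?fE ?pE //.
- rewrite antiB ?pB //; apply/eqP/eqP => [[->]//|pij].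
  by have := pE j i; rewrite -pij pE eqxx => /esym/eqP ->.
- by have /negPf -> := RAB _ _ (fA i) (pB _ (fA j)).
Qed.

(** Mirsky's peeling: the minimal elements [L] of [S] form an antichain, and if there are fewer than
    [t] of them, a chain found in the rest extends downwards by one element. *)
Lemma chain_or_antichain m t (S : {set V}) : m * t <= #|S| ->
  (exists s : seq V, [/\ size s = m, all (mem S) s & sorted (fun x y => R x y && (x != y)) s])
  \/ exists2 A : {set V}, A \subset S & t <= #|A| /\ antichain R A.
Proof.
have [Rr Ra Rt] := ordR.
elim: m S => [|m IHm] S mtS; first by left; exists [::].
pose L := [set x in S | [forall (y | y \in S), R y x ==> (y == x)]].
have sLS : L \subset S by apply/subsetP => x; rewrite inE => /andP[].
have Lmin x y : x \in L -> y \in S -> R y x -> y = x.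
  by rewrite inE => /andP[_ /forall_inP Lx] Sy; move/(implyP (Lx _ Sy))/eqP.
have antiL : antichain R L.
  move=> x y Lx Ly; apply/idP/eqP => [|->//].
  by apply: Lmin => //; apply: (subsetP sLS).
have [tL|Lt] := leqP t #|L|; first by right; exists L.
have cardS : #|S| = #|L| + #|S :\: L|.
  by rewrite -(cardsID L S); congr (_ + _); rewrite (setIidPr sLS).
have {}/IHm : m * t <= #|S :\: L| by lia.
case=> [[s [sz_s s_in s_sorted]]|[A sA antiA]]; last first.
  by right; exists A => //; apply: subset_trans sA (subsetDl _ _).
left; have s_inS : all (mem S) s.
  by apply: sub_all s_in => x /=; rewrite inE => /andP[].
case: s => [|x s] in sz_s s_in s_sorted s_inS *.
  have /card_gt0P[x Sx] : 0 < #|S| by lia.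
  by exists [:: x]; split => //=; [rewrite -sz_s | rewrite Sx].
have [Sx] : x \in S /\ x \notin L by move: s_in => /andP[/=]; rewrite inE => /andP[].
rewrite inE Sx /= => /forall_inPn[y Sy]; rewrite negb_imply => Ryx.
by exists [:: y, x & s]; split; rewrite /= ?Ryx -?sz_s // [_ \in _]Sy.
Qed.

Lemma sorted_embeds_chain m (s : seq V) : size s = m ->
  sorted (fun x y => R x y && (x != y)) s -> embeds (@chain_rel m) R.
Proof.
have [Rr Ra Rt] := ordR.
case: s => [<- _|x0 s sz_s srt].
  have f (i : 'I_0) : V by case: i.
  by apply: (@embedsI _ _ _ _ f) => // [[]|[]].
have Rlt : transitive (fun x y => R x y && (x != y)).
  move=> y x z /andP[Rxy xy] /andP[Ryz yz]; rewrite (Rt y) //=.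
  by apply: contra_neq xy => xz; apply: Ra; rewrite Rxy xz.
have mono i j : i < j -> j < m -> R (nth x0 (x0 :: s) i) (nth x0 (x0 :: s) j) &&
    (nth x0 (x0 :: s) i != nth x0 (x0 :: s) j).
  by move=> ij jm; apply: (sorted_ltn_nth Rlt x0 srt); rewrite ?inE ?sz_s //; lia.
apply: (@embedsI _ _ _ _ (fun i : 'I_m => nth x0 (x0 :: s) i)) => //.
  by move=> i j; rewrite /chain_rel -eqn_leq => /eqP/val_inj.
move=> i j; rewrite /chain_rel; have [ij|ji|/val_inj->] := ltngtP i j; last first.
- by rewrite Rr.
- have /andP[Rji /eqP nji] := mono _ _ ji (ltn_ord i); apply/esym/negP => Rij.
  by apply: nji; apply: Ra; rewrite Rij Rji.
- by have /andP[->] := mono _ _ ij (ltn_ord j).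
Qed.

Lemma antichain_of_nochain m t (S : {set V}) : ~ embeds (@chain_rel m) R ->
  m * t <= #|S| -> exists2 A : {set V}, A \subset S & t <= #|A| /\ antichain R A.
Proof.
move=> nochain /chain_or_antichain[[s [sz_s _ srt]]|//].
by case: nochain; apply: sorted_embeds_chain sz_s srt.
Qed.

End OrderFacts.

(** * Elements above a large antichain *)

Section Half.
Variables (V : finType) (R : rel V) (m : nat) (A : {set V}).
Hypothesis ordR : is_order R.
Hypothesis nochain : ~ embeds (@chain_rel m) R.
Hypothesis nobiclique : ~ embeds (@biclique_rel m) R.
Hypothesis nostar : ~ embeds (@star_rel m) R.
Hypothesis nocostar : ~ embeds (@star_rel m) (fun x y => R y x).
Hypothesis nomatching : ~ embeds (@matching_rel m) R.
Hypothesis antiA : antichain R A.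
Hypothesis largeA : m * m + m <= #|A|.

Let below x := [set a in A | R a x].
Let upper := [set x | (x \notin A) && (below x != set0)].

Lemma flip_order : is_order (fun x y => R y x).
Proof.
have [Rr Ra Rt] := ordR; split=> [x|x y|y x z yx zy]; first exact: Rr.
  by rewrite andbC; apply: Ra.
exact: Rt zy yx.
Qed.

Lemma upper_not_below x a : x \in upper -> a \in A -> R x a = false.
Proof.
have [Rr Ra Rt] := ordR.
rewrite inE => /andP[xA /set0Pn[b]]; rewrite inE => /andP[Ab Rbx] Aa.
apply/negP => Rxa; have := Rt _ _ _ Rbx Rxa; rewrite antiA // => /eqP ba; move/negP: xA; apply.
by rewrite (Ra x a) // Rxa -ba Rbx.
Qed.

(** Otherwise [x] is the centre of a dual star: at least [m] elements of [A] lie below it and at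
    least [m] are incomparable to it. *)
Lemma below_small_or_large x : x \in upper -> #|below x| < m \/ #|A :\: below x| < m.
Proof.
move=> Ux; have [//|le1] := ltnP #|below x| m; first by left.
have [//|le2] := ltnP #|A :\: below x| m; first by right.
case: nocostar; apply: (@embeds_star _ _ flip_order m x (below x) (A :\: below x)) => //.
- apply: antichain_flip; apply: antichainS antiA.
  by rewrite subUset subsetDl andbT; apply/subsetP => a; rewrite inE => /andP[].
- by apply/pred0P => a /=; rewrite !inE; case: (a \in A); case: (R a x).
- by move=> a; rewrite inE => /andP[Aa Rax] /=; rewrite Rax (upper_not_below Ux Aa).
- by move=> a; rewrite !inE => /andP[+ Aa] /=; rewrite Aa (upper_not_below Ux Aa) => ->.
Qed.

(** Among [m * m] such elements there is an antichain of size [m]. All but at most [m * m] elements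
    of [A], hence by [largeA] at least [m], lie below every member of it, and this is a complete
    bipartite poset. *)
Lemma card_large_below : #|[set x in upper | #|A :\: below x| < m]| < m * m.
Proof.
rewrite ltnNge; apply/negP => /(antichain_of_nochain ordR nochain)[E sE [mE antiE]].
have [f f_inj fE] := ord_inj_in_set mE.
have inE' i : f i \in upper /\ #|A :\: below (f i)| < m.
  by move: (subsetP sE _ (fE i)); rewrite inE => /andP[].
pose B := \bigcup_(i in [set: 'I_m]) (A :\: below (f i)).
have leB : #|B| <= m * m.
  have := @leq_card_bigcup _ _ [set: 'I_m] (fun i => A :\: below (f i)) m.
  by rewrite cardsT card_ord; apply=> i _; apply: ltnW; case: (inE' i).
apply: nobiclique; apply: (@embeds_biclique _ _ ordR m (A :\: B) (f @: setT)).
- by have := cardsID B A; have := subset_leq_card (subsetIr A B); lia.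
- by rewrite card_imset // cardsT card_ord.
- by apply: antichainS antiA; apply: subsetDl.
- by apply: antichainS antiE; apply/subsetP => _ /imsetP[i _ ->].
- move=> a _ + /imsetP[i _ ->]; rewrite inE => /andP[aB Aa].
  have [Ufi _] := inE' i; rewrite (upper_not_below Ufi Aa) andbT.
  apply: contraR aB => Rfi; apply/bigcupP; exists i => //.
  by rewrite !inE Aa Rfi.
Qed.

(** The three factors of [m * m * m] bound an antichain [D] of such elements: fewer than [m] of them
    have pairwise disjoint sets [below x] (no matching), each of these sets has fewer than [m]
    elements, and each element of [A] lies below fewer than [m] elements of [D] (no star). *)
Lemma card_small_below : #|[set x in upper | #|below x| < m]| < m * (m * m * m).
Proof.
have [Rr Ra Rt] := ordR.
rewrite ltnNge; apply/negP => /(antichain_of_nochain ordR nochain)[D sD [mD antiD]].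
have inD x : x \in D -> x \in upper /\ #|below x| < m.
  by move=> /(subsetP sD); rewrite inE => /andP[].
have below_sub x : below x \subset A by apply/subsetP => a; rewrite inE => /andP[].
(* Otherwise [a] is the centre of a star: its leaves are [m] elements of [D], and the isolated
   points are the elements of [A] that lie below none of these leaves. *)
have above a : a \in A -> #|[set x in D | R a x]| < m.
  move=> Aa; rewrite ltnNge; apply/negP => /ord_inj_in_set[f f_inj fD].
  have {}fD i : f i \in D /\ R a (f i) by move: (fD i); rewrite inE => /andP[].
  pose B := \bigcup_(i in [set: 'I_m]) below (f i).
  have leB : #|B| <= m * m.
    have := @leq_card_bigcup _ _ [set: 'I_m] (fun i => below (f i)) m.
    by rewrite cardsT card_ord; apply=> i _; apply: ltnW; case: (inD (f i)) => //; case: (fD i).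
  have ltA (i : 'I_m) b : b \in A -> R (f i) b = false.
    by apply: upper_not_below; case: (inD (f i)) => //; case: (fD i).
  have fA i : f i \notin A by case: (fD i) => /inD[]; rewrite inE => /andP[].
  have RB (i : 'I_m) b : b \in A :\: B -> R b (f i) = false.
    rewrite inE => /andP[+ Ab]; apply: contraNF => Rb; apply/bigcupP; exists i => //.
    by rewrite inE Ab.
  (* The empty chain embeds everywhere, so [nochain] forces [m] to be positive. *)
  have m_gt0 : 0 < m.
    case: (posnP m) => // m0; case: nochain; rewrite m0.
    exact: (sorted_embeds_chain ordR (s := [::])).
  have aB : a \in B.
    by apply/bigcupP; exists (Ordinal m_gt0) => //; rewrite inE Aa; case: (fD (Ordinal m_gt0)).
  apply: nostar; apply: (@embeds_star _ _ ordR m a (f @: setT) (A :\: B)).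
  - by rewrite card_imset // cardsT card_ord.
  - by have := cardsID B A; have := subset_leq_card (subsetIr A B); lia.
  - move=> x y; rewrite !in_setU => /orP[/imsetP[i _ ->]|Bx] /orP[/imsetP[j _ ->]|By].
    + by apply: antiD; [case: (fD i) | case: (fD j)].
    + have Ay : y \in A by move: By; rewrite inE => /andP[].
      by rewrite ltA //; apply/esym/negP => /eqP fy; move: (fA i); rewrite fy Ay.
    + have Ax : x \in A by move: Bx; rewrite inE => /andP[].
      by rewrite RB //; apply/esym/negP => /eqP fy; move: (fA j); rewrite -fy Ax.
    + by apply: antiA; [move: Bx | move: By]; rewrite inE => /andP[].
  - rewrite disjoint_sym; apply/pred0P => x /=; apply/negP => /andP[+ /imsetP[i _ xE]].
    by rewrite xE inE (negPf (fA i)) andbF.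
  - by move=> _ /imsetP[i _ ->]; rewrite ltA //; case: (fD i) => _ ->.
  - move=> b Bb; have /andP[bB Ab] : (b \notin B) && (b \in A) by rewrite inE in Bb.
    by rewrite !antiA // [b == a]eq_sym andbb; apply: contraNneq bB => <-.
(* Every element of D shares a lower bound with a maximal subfamily of D whose
   sets [below x] are disjoint, and a large such subfamily gives a matching. *)
pose disj (F : {set V}) := (F \subset D) &&
  [forall x in F, forall y in F, (x != y) ==> [disjoint below x & below y]].
have disj0 : disj set0.
  by rewrite /disj sub0set; apply/forall_inP => x; rewrite inE.
case: (arg_maxnP (fun F : {set V} => #|F|) disj0) => F /andP[sFD /forall_inP disjF] maxF.
have [mF|Fm] := leqP m #|F|.
  pose p x := odflt x [pick a in below x].
  have pP x : x \in F -> p x \in below x.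
    move=> /(subsetP sFD)/inD[]; rewrite inE => /andP[_ /set0Pn[a xa]] _.
    by rewrite /p; case: pickP => [//|/(_ a)]; rewrite xa.
  have pA x : x \in F -> p x \in A by move/pP; apply: (subsetP (below_sub x)).
  apply: nomatching; apply: (@embeds_matching _ _ ordR m F A p) => //.
  - exact: antichainS antiD.
  - move=> x y Fx Fy; have [->|xy] := eqVneq x y.
      by move: (pP _ Fy); rewrite inE => /andP[].
    have dxy := implyP (forall_inP (disjF x Fx) y Fy) xy.
    by apply/negP => Rpy; have := disjointFr dxy (pP _ Fx); rewrite inE Rpy pA.
  - by move=> x a Fx Aa; rewrite upper_not_below //; case: (inD x) => //; apply: (subsetP sFD).
have sDF : D \subset \bigcup_(x in F) \bigcup_(a in below x) [set y in D | R a y].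
  apply/subsetP => y Dy; apply: contraT => ny.
  have disjy x : x \in F -> [disjoint below x & below y].
    move=> Fx; apply/pred0P => a /=; apply/negP => /andP[xa ya].
    move/negP: ny; apply; apply/bigcupP; exists x => //; apply/bigcupP; exists a => //.
    by rewrite inE Dy; move: ya; rewrite inE => /andP[].
  have /set0Pn[a ya] : below y != set0 by case: (inD y Dy); rewrite inE => /andP[].
  have nFy : y \notin F.
    by apply/negP => /disjy /pred0P/(_ a) /=; rewrite ya.
  suff : disj (y |: F) by move=> /maxF; rewrite cardsU1 nFy /=; lia.
  rewrite /disj subUset sub1set Dy sFD; apply/forall_inP => x /setU1P[->|Fx];
    apply/forall_inP => z /setU1P[->|Fz]; apply/implyP; rewrite ?eqxx // => xz.
  - by rewrite disjoint_sym disjy.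
  - exact: disjy.
  - exact: implyP (forall_inP (disjF x Fx) z Fz) xz.
have := subset_leq_card sDF.
have /leq_trans bound :
    #|\bigcup_(x in F) \bigcup_(a in below x) [set y in D | R a y]| <= #|F| * (m * m).
  apply: leq_card_bigcup => x Fx; have [_ /ltnW ltx] := inD _ (subsetP sFD _ Fx).
  apply: leq_trans (leq_mul ltx (leqnn m)); apply: leq_card_bigcup => a xa.
  by apply: ltnW; apply: above; apply: (subsetP (below_sub x)).
move=> /leq_trans/(_ (bound _ (leqnn _))); nia.
Qed.

Lemma card_upper : #|upper| <= m * m + m * (m * m * m).
Proof.
apply: leq_trans (leq_add (ltnW card_large_below) (ltnW card_small_below)).
apply: leq_trans (leq_card_setU _ _); apply: subset_leq_card.
apply/subsetP => x Ux; rewrite !(inE, in_setU).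
by case: (below_small_or_large Ux) => ->; rewrite inE in Ux; rewrite Ux ?orbT.
Qed.

(** [B] is the minority side when [A] is split into the elements below [x] and the others. *)
Lemma upper_constant x : x \in upper -> exists B : {set V},
  #|B| <= m /\ {in A :\: B &, forall a b, R a x = R b x}.
Proof.
move=> /below_small_or_large[/ltnW le_m|/ltnW le_m].
  exists (below x); split=> // a b; rewrite !inE => /andP[+ Aa] /andP[+ Ab].
  by rewrite Aa Ab /= => /negPf-> /negPf->.
exists (A :\: below x); split=> // a b; rewrite !inE => /andP[+ Aa] /andP[+ Ab].
by rewrite Aa Ab /= !andbT !negbK => -> ->.
Qed.

End Half.

(** * Bounded exceptional sets *)

(** Only the star is listed together with its dual: the other three patterns are self-dual, so the
    whole notion is invariant under reversal. *)
Definition pattern_free (V : finType) m (R : rel V) : Prop :=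
  [/\ ~ embeds (@chain_rel m) R, ~ embeds (@biclique_rel m) R,
      ~ embeds (@star_rel m) R, ~ embeds (@star_rel m) (fun x y => R y x)
    & ~ embeds (@matching_rel m) R].

Lemma embeds_flip_auto (V W : finType) (S : rel V) (R : rel W) (f : V -> V) :
  injective f -> (forall x y, S x y = S (f y) (f x)) ->
  embeds S (fun x y => R y x) -> embeds S R.
Proof.
move=> f_inj Sf [g g_inj SR]; exists (g \o f); first exact: inj_comp.
by move=> x y; rewrite Sf SR.
Qed.

Lemma pattern_free_flip (V : finType) m (R : rel V) :
  pattern_free m R -> pattern_free m (fun x y => R y x).
Proof.
pose swap (x : 'I_m + 'I_m) := match x with inl i => inr i | inr i => inl i end.
have swap_inj : injective swap by move=> [i|i] [j|j] //= [->].
move=> [nch nbi nst nco nma]; split=> // emb.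
- apply: nch; apply: embeds_flip_auto (@rev_ord_inj m) _ emb => i j.
  by rewrite /chain_rel /=; have := ltn_ord i; have := ltn_ord j; lia.
- by apply: nbi; apply: embeds_flip_auto swap_inj _ emb => [[i|i] [j|j]] //=; rewrite eq_sym.
- by apply: nma; apply: embeds_flip_auto swap_inj _ emb => [[i|i] [j|j]] //=; rewrite eq_sym.
Qed.

(** The complement consists of mutually incomparable twins, but [S] need not be minimal; the core is
    extracted from it later. *)
Definition exceptional (V : finType) (R : rel V) (S : {set V}) : Prop :=
  antichain R (~: S) /\
  {in ~: S &, forall u v, {in S, forall z, R z u = R z v /\ R u z = R v z}}.

Lemma pattern_free_exceptional m : exists M, forall (V : finType) (R : rel V),
  is_order R -> pattern_free m R -> exists2 S : {set V}, #|S| <= M & exceptional R S.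
Proof.
pose b := m * m + m * (m * m * m).
(* The first summand covers posets too small to guarantee an antichain of size [m * m + m]. In the
   second, [b] bounds the elements on one side of [A], [b * m] the elements of [A] that they treat
   exceptionally, and the factor 2 accounts for both sides. *)
exists (m * (m * m + m) + (b + b * m) * 2) => V R ordR freeR.
have [Rr Ra Rt] := ordR; have [nch nbi nst nco nma] := freeR.
have [nch' nbi' nst' _ nma'] := pattern_free_flip freeR.
have [small|large] := leqP #|V| (m * (m * m + m)).
  exists setT; first by rewrite cardsT; lia.
  by split=> [u v|u v]; rewrite setCT inE.
have [A0 _ [sz0 anti0]] : exists2 A : {set V}, A \subset setT & m * m + m <= #|A| /\ antichain R A.
  by apply: (antichain_of_nochain ordR nch); rewrite cardsT ltnW.
pose ac (A : {set V}) := [forall x in A, forall y in A, R x y == (x == y)].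
have acP A : reflect (antichain R A) (ac A).
  apply: (iffP forall_inP) => H x => [y Ax Ay|Ax].
    by apply/eqP; apply: (forall_inP (H x Ax)).
  by apply/forall_inP => y Ay; apply/eqP/H.
move/acP in anti0.
case: (arg_maxnP (fun A : {set V} => #|A|) anti0) => A /acP antiA maxA.
have szA : m * m + m <= #|A| by apply: leq_trans sz0 (maxA _ anti0).
have antiA' := antichain_flip antiA; have ordR' := flip_order ordR.
have cardU := card_upper ordR nch nbi nst nco nma antiA szA.
have cardW := card_upper ordR' nch' nbi' nst' nst nma' antiA' szA.
have cstU := upper_constant ordR nco antiA.
have cstW := upper_constant ordR' nst antiA'.
have nbelU := upper_not_below ordR antiA.
have nbelW := upper_not_below ordR' antiA'.
set U := [set x | _] in cardU cstU nbelU; set W := [set x | _] in cardW cstW nbelW.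
(* By maximality of [A]: an element neither above nor below any element of [A] could be added to
   it. *)
have UW x : x \notin A -> x \in U :|: W.
  move=> nAx; apply: contraT; rewrite !inE nAx /= negb_or !negbK => /andP[/eqP bx /eqP wx].
  have ax a : a \in A -> R a x = false.
    by move=> Aa; apply/negP => Rax; have := in_set0 a; rewrite -bx inE Aa Rax.
  have xa a : a \in A -> R x a = false.
    by move=> Aa; apply/negP => Rax; have := in_set0 a; rewrite -wx inE Aa Rax.
  suff /acP/maxA : antichain R (x |: A) by rewrite cardsU1 nAx; lia.
  move=> y z /setU1P[->|Ay] /setU1P[->|Az]; rewrite ?Rr ?eqxx ?ax ?xa ?antiA //.
    by apply/esym; apply: contraNF nAx => /eqP->.
  by apply/esym; apply: contraNF nAx => /eqP<-.
(* Collecting the exceptional subsets of all elements of [X] leaves a part of [A] on which each of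
   them is constant. *)
have bad (X : {set V}) (Q : V -> V -> bool) : (forall x, x \in X -> exists B : {set V},
    #|B| <= m /\ {in A :\: B &, forall a b, Q a x = Q b x}) ->
    exists2 B : {set V}, #|B| <= #|X| * m &
    {in X, forall x, {in A :\: B &, forall a b, Q a x = Q b x}}.
  move=> HX; have /choice[B HB] : forall x, exists B : {set V}, x \in X ->
    #|B| <= m /\ {in A :\: B &, forall a b, Q a x = Q b x}.
    move=> x; have [/HX[B HB]|] := boolP (x \in X); first by exists B.
    by exists set0.
  exists (\bigcup_(x in X) B x); first by apply: leq_card_bigcup => x /HB[].
  move=> x Xx; have [_ HBx] := HB x Xx => a c; rewrite !in_setD => /andP[na Aa] /andP[nc Ac].
  apply: HBx; rewrite in_setD ?Aa ?Ac andbT.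
    by apply: contra na => ?; apply/bigcupP; exists x.
  by apply: contra nc => ?; apply/bigcupP; exists x.
have [BU szBU HU] := bad U R cstU.
have [BW szBW HW] := bad W (fun x y => R y x) cstW.
exists (~: A :|: BU :|: BW).
  have cA : #|~: A| <= b + b.
    apply: leq_trans (leq_add cardU cardW); apply: leq_trans (leq_card_setU _ _).
    by apply: subset_leq_card; apply/subsetP => x; rewrite in_setC => /UW.
  have szBU' := leq_trans szBU (leq_mul cardU (leqnn m)).
  have szBW' := leq_trans szBW (leq_mul cardW (leqnn m)).
  rewrite -/b in szBU' szBW'.
  have c1 : #|~: A :|: BU :|: BW| <= _ := leq_card_setU (~: A :|: BU) BW.
  have c2 : #|~: A :|: BU| <= _ := leq_card_setU (~: A) BU.
  lia.
have inC u : u \in ~: (~: A :|: BU :|: BW) -> [/\ u \in A, u \in A :\: BU & u \in A :\: BW].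
  by rewrite !inE !negb_or negbK -andbA => /and3P[-> -> ->].
split=> [u v /inC[Au _ _] /inC[Av _ _]|u v Cu Cv z Sz]; first exact: antiA.
have [Au Uu Wu] := inC u Cu; have [Av Uv Wv] := inC v Cv.
have [Az|/UW] := boolP (z \in A).
  have zu : z != u by apply: contraTneq Cu => <-; rewrite inE Sz.
  have zv : z != v by apply: contraTneq Cv => <-; rewrite inE Sz.
  by rewrite !antiA // ![_ == z]eq_sym (negPf zu) (negPf zv).
rewrite in_setU => /orP[Uz|Wz].
  by rewrite (nbelU z u) // (nbelU z v) //; split=> //; apply: HU.
by rewrite (nbelW z u) // (nbelW z v) //; split=> //; apply: HW.
Qed.

(** * Lower bounds from large configurations *)

Lemma exp2_leq_fact n : 4 <= n -> 2 ^ n <= n`!.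
Proof.
elim: n => [//|n IHn]; rewrite leq_eqVlt => /predU1P[<-//|lt4n].
by rewrite expnS factS leq_mul // ?IHn //; lia.
Qed.

Section Counting.
Variable P : poset_collection.
Hypothesis Pher : hereditary_property P.

Lemma leq_card_speed (I : finType) (X : {set I}) n (F : I -> rel 'I_n) :
  (forall x, x \in X -> realized P (F x)) ->
  {in X &, forall x y, F x =2 F y -> x = y} -> #|X| <= speed P n.
Proof.
move=> FP F_inj; have relF_inj : {in X &, injective (fun x => relset (F x))}.
  move=> x y Xx Xy eqF; apply: F_inj => // i j.
  by rewrite -(pair_relset (F x)) eqF pair_relset.
rewrite -(card_in_imset relF_inj) subset_leq_card //.
by apply/subsetP => _ /imsetP[x Xx ->]; apply: relset_members; [|apply: FP].
Qed.

Lemma speed_of_chains : (forall m, realized P (@chain_rel m)) ->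
  forall n, 4 <= n -> 2 ^ n - 1 <= speed P n.
Proof.
move=> Pch n n4; apply: leq_trans (leq_subr _ _) _; apply: leq_trans (exp2_leq_fact n4) _.
rewrite -card_Sn -cardsT.
apply: (@leq_card_speed _ _ _ (fun (s : {perm 'I_n}) i j => s i <= s j)) => [s _|s t _ _ st].
  by apply: realized_embeds (Pch n); exists s => //; apply: perm_inj.
(* The position of [i] is the number of elements strictly below it, so the chain determines the
   permutation. *)
have rank (u : {perm 'I_n}) i : val (u i) = #|[set j | ~~ (u i <= u j)]|.
  have -> : [set j | ~~ (u i <= u j)] = u @^-1: [set k : 'I_n | k < u i].
    by apply/setP => j; rewrite !inE ltnNge.
  rewrite card_preimset; last exact: perm_inj.
  have le_ui : u i <= n by apply: ltnW.
  have -> : [set k : 'I_n | k < u i] = [set widen_ord le_ui k | k : 'I_(u i)].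
    apply/setP => k; rewrite inE; apply/idP/imsetP => [lt_k|[l _ ->]]; last by rewrite /= ltn_ord.
    by exists (Ordinal lt_k) => //; apply: val_inj.
  by rewrite card_imset ?card_ord // => k l /(congr1 val)/= /val_inj.
apply/permP => i; apply: val_inj; rewrite (rank s i) (rank t i); congr (#|pred_of_set _|).
by apply/setP => j; rewrite !inE st.
Qed.

(** Every subset serves as the lower side. The full set is left out because it gives the antichain,
    just as the empty set does. *)
Lemma speed_of_bicliques : (forall m, realized P (@biclique_rel m)) ->
  forall n, 2 ^ n - 1 <= speed P n.
Proof.
move=> Pbi n; have -> : 2 ^ n - 1 = #|[set~ [set: 'I_n]]|.
  by rewrite cardsC1 -cardsT -powersetT card_powerset cardsT card_ord subn1.
apply: (@leq_card_speed _ _ _ (fun (A : {set 'I_n}) i j => (i == j) || (i \in A) && (j \notin A))).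
  move=> A _; apply: realized_embeds (Pbi n).
  exists (fun i => if i \in A then inl i else inr i) => [i j|i j].
    by case: ifP => Ai; case: ifP => Aj // [->].
  by case: (boolP (i \in A)) => Ai; case: (boolP (j \in A)) => Aj;
    rewrite /= ?orbF ?orbT //; apply/negP => /eqP ij; rewrite ij ?Aj ?(negPf Aj) in Ai.
move=> A B; rewrite !inE => AT BT AB.
have sub (C D : {set 'I_n}) : C != setT -> (forall i j, (i == j) || (i \in C) && (j \notin C) =
    (i == j) || (i \in D) && (j \notin D)) -> C \subset D.
  rewrite -subTset => /subsetPn[j _ Cj] CD; apply/subsetP => i Ci.
  have := CD i j; rewrite Ci Cj orbT; have [ij|_ /esym/andP[]//] := eqVneq i j.
  by rewrite -ij Ci in Cj.
by apply/eqP; rewrite eqEsubset !sub // => i j; rewrite AB.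
Qed.

(** [2 ^ n.+1 - 1] is twice the number of subsets avoiding one label, minus one for the member that
    the two families may share. *)
Lemma leq_two_families n (F G : {set 'I_n.+1} -> rel 'I_n.+1) :
  let X := powerset [set~ ord0] in
  (forall A, A \in X -> realized P (F A)) ->
  (forall A, A \in X -> realized P (G A)) ->
  {in X &, forall A B, F A =2 F B -> A = B} ->
  {in X &, forall A B, G A =2 G B -> A = B} ->
  {in X &, forall A B, F A =2 G B -> B = set0} ->
  2 ^ n.+1 - 1 <= speed P n.+1.
Proof.
move=> X FP GP F_inj G_inj FG.
have X0 : set0 \in X by rewrite inE sub0set.
have cardX : #|X| = 2 ^ n by rewrite card_powerset cardsC1 card_ord.
pose Y : {set bool * {set 'I_n.+1}} := setX [set: bool] X :\ (true, set0).
have -> : 2 ^ n.+1 - 1 = #|Y|.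
  have := cardsD1 (true, set0) (setX [set: bool] X).
  rewrite cardsX cardsT card_bool cardX in_setX inE X0 -/Y expnS => -> /=; rewrite addKn //.
apply: (@leq_card_speed _ Y _ (fun p => if p.1 then G p.2 else F p.2)).
  by move=> [[] A]; rewrite in_setD1 in_setX => /and3P[_ _ XA]; [apply: GP | apply: FP].
move=> [[] A] [[] B]; rewrite !in_setD1 !in_setX => /and3P[nA _ XA] /and3P[nB _ XB] E.
- by rewrite (G_inj A B).
- by move: nA; rewrite (FG B A) ?eqxx // => i j; rewrite E.
- by move: nB; rewrite (FG A B) ?eqxx.
- by rewrite (F_inj A B).
Qed.

Definition flip_if (dual : bool) (V : Type) (R : rel V) : rel V :=
  if dual then fun x y => R y x else R.

(** The two families are the stars centred at the first and at the last label, which differ because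
    [1 < n]. A star with a leaf determines its centre, so only the antichain is common to both. *)
Lemma speed_of_stars dual : (forall m, realized P (flip_if dual (@star_rel m))) ->
  forall n, 1 < n -> 2 ^ n - 1 <= speed P n.
Proof.
move=> Pst [//|[//|n]] _.
pose o : 'I_n.+2 := ord0; pose s := tperm o (ord_max : 'I_n.+2).
pose F (A : {set 'I_n.+2}) : rel 'I_n.+2 := fun i j => (i == j) || (i == o) && (j \in A).
have so : s o = ord_max by rewrite tpermL.
have FP A : A \in powerset [set~ o] -> embeds (F A) (@star_rel n.+2).
  rewrite inE => /subsetP oA.
  have {}oA : o \notin A by apply/negP => /oA; rewrite !inE eqxx.
  exists (fun i => if i == o then None else Some (if i \in A then inl i else inr i)).
    move=> i j; case: eqP => [->|_]; case: eqP => [-> //|_] //.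
    by case: ifP; case: ifP => // _ _ [->].
  move=> i j; rewrite /F; have [->|io] := eqVneq i o.
    have [->//|oj] := eqVneq j o.
    by rewrite /=; case: ifP.
  rewrite /= orbF; have [->|jo] := eqVneq j o; first by rewrite (negPf io); case: ifP.
  by case: (boolP (i \in A)) => Ai; case: (boolP (j \in A)) => Aj //;
    apply/negP => /eqP ij; rewrite ij ?Aj ?(negPf Aj) in Ai.
have F_inj : {in powerset [set~ o] &, forall A B, F A =2 F B -> A = B}.
  have sub (A B : {set 'I_n.+2}) : A \in powerset [set~ o] -> F A =2 F B -> A \subset B.
    rewrite inE => /subsetP oA FAB; apply/subsetP => i Ai; have := FAB o i.
    rewrite /F eqxx Ai /= orbT; have := oA _ Ai; rewrite !inE eq_sym => /negPf-> /=.
    by move=> <-.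
  by move=> A B XA XB FAB; apply/eqP; rewrite eqEsubset !sub // => i j; rewrite FAB.
have FP' A : A \in powerset [set~ o] -> realized P (flip_if dual (F A)).
  move=> /FP emb; apply: realized_embeds (Pst n.+2); rewrite /flip_if.
  by case: (dual) => //; apply: embeds_flip.
have unflip (R S : rel 'I_n.+2) : flip_if dual R =2 flip_if dual S -> R =2 S.
  by rewrite /flip_if; case: (dual) => // RS i j; apply: RS.
apply: (@leq_two_families _ (fun A => flip_if dual (F A))
  (fun A => flip_if dual (fun i j => F A (s i) (s j)))) => //.
- move=> A XA; apply: realized_embeds (FP' A XA).
  by exists s; [apply: perm_inj | rewrite /flip_if; case: (dual)].
- by move=> A B XA XB /unflip; apply: F_inj.
- move=> A B XA XB /unflip E; apply: F_inj => // i j.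
  by have := E (s i) (s j); rewrite !tpermK.
- move=> A B XA XB /unflip E; apply/eqP/set0Pn => -[b Bb].
  have ob : b != o.
    apply: contraTneq XB => ob; rewrite inE; apply/subsetPn.
    by exists b; rewrite // !inE ob eqxx.
  have := E (s o) (s b); rewrite /F !tpermK eqxx Bb orbT (inj_eq perm_inj).
  by rewrite [o == b]eq_sym (negPf ob) so.
Qed.

Section MatchingOfSet.
Variables (n : nat) (E : {set 'I_n.+1}).

Let rank i := index i (enum E).

(* Pairs the consecutive elements of E; the elements outside E are sent to
   endpoints of edges not used by E. *)
Definition pair_up (i : 'I_n.+1) : 'I_(n.+1 + n.+1) + 'I_(n.+1 + n.+1) :=
  if i \in E then
    if odd (rank i) then inr (lshift n.+1 (inord (rank i)./2))
    else inl (lshift n.+1 (inord (rank i)./2))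
  else inl (rshift n.+1 i).

Lemma half_rank i : i \in E -> (rank i)./2 < n.+1.
Proof.
move=> Ei; have : rank i < #|E| by rewrite cardE index_mem mem_enum.
by have := subset_leq_card (subsetT E); rewrite cardsT card_ord; lia.
Qed.

Lemma pair_up_inj : injective pair_up.
Proof.
move=> i j; rewrite /pair_up; case: (boolP (i \in E)) => Ei; case: (boolP (j \in E)) => Ej.
- have eq_rank : odd (rank i) = odd (rank j) ->
    inord (rank i)./2 = inord (rank j)./2 :> 'I_n.+1 -> i = j.
    move=> odd_ij /(congr1 val); rewrite /= !inordK ?half_rank // => half_ij.
    have := odd_double_half (rank i); rewrite odd_ij half_ij odd_double_half => rank_ij.
    by apply: (@index_inj _ i (enum E)) => //; rewrite mem_enum.
  by case: ifP => oi; case: ifP => oj // [] /val_inj; apply: eq_rank; rewrite oi oj.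
- by case: ifP => // _ [] eq_ij; have := ltn_ord (inord (rank i)./2 : 'I_n.+1); lia.
- by case: ifP => // _ [] eq_ij; have := ltn_ord (inord (rank j)./2 : 'I_n.+1); lia.
- by move=> [] /addnI/val_inj.
Qed.

Definition pairing_rel : rel 'I_n.+1 := fun i j => matching_rel (pair_up i) (pair_up j).

(** When [#|E|] is even, every rank has a partner, the next one if it is even and the previous one
    if it is odd. So [E] is recovered from the order as the set of points that are not isolated. *)
Lemma pairing_rel_support i : ~~ odd #|E| ->
  (i \in E) = [exists j, (j != i) && (pairing_rel i j || pairing_rel j i)].
Proof.
move=> evenE; apply/idP/existsP => [Ei|[j /andP[ij]]].
  have rank_i : rank i < #|E| by rewrite cardE index_mem mem_enum.
  have rank_nth k : k < #|E| -> (nth i (enum E) k \in E) /\ rank (nth i (enum E) k) = k.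
    by move=> kE; rewrite -mem_enum mem_nth -?cardE // /rank index_uniq ?enum_uniq -?cardE.
  have [odd_i|even_i] := boolP (odd (rank i)).
    have [|Ej rank_j] := rank_nth (rank i).-1; first by lia.
    exists (nth i (enum E) (rank i).-1); apply/andP; split.
      by apply/eqP => ji; move: rank_j; rewrite ji; lia.
    rewrite /pairing_rel /pair_up Ei Ej odd_i rank_j.
    have -> : odd (rank i).-1 = false by lia.
    have -> : (rank i).-1./2 = (rank i)./2 by lia.
    by rewrite /= eqxx.
  have [|Ej rank_j] := rank_nth (rank i).+1; first by lia.
  exists (nth i (enum E) (rank i).+1); apply/andP; split.
    by apply/eqP => ji; move: rank_j; rewrite ji; lia.
  rewrite /pairing_rel /pair_up Ei Ej (negPf even_i) rank_j /= even_i.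
  have -> : uphalf (rank i) = (rank i)./2 by lia.
  by rewrite /= eqxx.
apply: contraTT => nEi; rewrite /pairing_rel /pair_up (negPf nEi) negb_or.
have inlE (k l : 'I_(n.+1 + n.+1)) : (inl k == inl l :> 'I__ + 'I__) = (k == l) by [].
case: (boolP (j \in E)) => Ej; first by case: ifP => _ /=; rewrite ?inlE ?eq_shift.
by rewrite /= !inlE !eq_shift eq_sym andbb.
Qed.

Lemma pairing_rel_anti : antisymmetric pairing_rel.
Proof. by move=> i j /matching_anti/pair_up_inj. Qed.

End MatchingOfSet.

(** Adding [o] when needed turns the subsets avoiding [o] into the even subsets of all labels. The
    two families are the pairings of these sets and their reverses; an order in both equals its own
    reverse, so by antisymmetry it has no edge. *)
Lemma speed_of_matchings : (forall m, realized P (@matching_rel m)) ->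
  forall n, 0 < n -> 2 ^ n - 1 <= speed P n.
Proof.
move=> Pma [//|n] _; pose o : 'I_n.+1 := ord0.
pose ev (A : {set 'I_n.+1}) := if odd #|A| then o |: A else A.
have Xo A : A \in powerset [set~ o] -> o \notin A.
  by rewrite inE => /subsetP oA; apply/negP => /oA; rewrite !inE eqxx.
have ev_even A : A \in powerset [set~ o] -> ~~ odd #|ev A|.
  by move=> /Xo oA; rewrite /ev; case: ifP => [oddA|->//]; rewrite cardsU1 oA /= oddA.
have ev_inj : {in powerset [set~ o] &, injective ev}.
  have evD A : A \in powerset [set~ o] -> ev A :\ o = A.
    move=> /Xo oA; rewrite /ev; case: ifP => _; first by rewrite setU1K.
    by apply/setP => i; rewrite !inE; case: eqP => [->|//]; rewrite (negPf oA).
  by move=> A B XA XB E; rewrite -(evD A) // E evD.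
have supp A : A \in powerset [set~ o] -> forall i,
    (i \in ev A) = [exists j, (j != i) && (pairing_rel (ev A) i j || pairing_rel (ev A) j i)].
  by move=> XA i; apply: pairing_rel_support; apply: ev_even.
have FP A : realized P (pairing_rel (ev A)).
  by apply: realized_embeds (Pma (n.+1 + n.+1)); exists (pair_up (ev A)); [apply: pair_up_inj|].
apply: (@leq_two_families _ (fun A => pairing_rel (ev A))
  (fun A i j => pairing_rel (ev A) j i)) => //.
- move=> A XA; apply: realized_embeds (Pma (n.+1 + n.+1)).
  pose swap (x : 'I_(n.+1 + n.+1) + 'I_(n.+1 + n.+1)) :=
    match x with inl i => inr i | inr i => inl i end.
  exists (swap \o pair_up (ev A)).
    by apply: inj_comp (@pair_up_inj _ _) => [[i|i] [j|j]] //= [->].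
  move=> i j; rewrite /pairing_rel /=.
  by case: (pair_up _ i) => k; case: (pair_up _ j) => l //=; rewrite eq_sym.
- move=> A B XA XB E; apply: ev_inj => //; apply/setP => i; rewrite !supp //.
  by apply: eq_existsb => j; rewrite !E.
- move=> A B XA XB E; apply: ev_inj => //; apply/setP => i; rewrite !supp //.
  by apply: eq_existsb => j; have := E i j; have := E j i => /= -> ->.
- move=> A B XA XB E.
  have evAB : ev A = ev B.
    by apply/setP => i; rewrite !supp //; apply: eq_existsb => j; rewrite !E orbC.
  suff : ev B = ev set0 by apply: ev_inj; rewrite // inE sub0set.
  rewrite {2}/ev cards0 /=; apply/eqP/set0Pn => -[i]; rewrite supp // => /existsP[j].
  have sym : pairing_rel (ev B) i j = pairing_rel (ev B) j i by rewrite -{1}evAB E.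
  case/andP => /eqP ij; rewrite sym orbb => Rji; apply: ij.
  by apply: (@pairing_rel_anti _ (ev B)); rewrite sym Rji.
Qed.

End Counting.

(** * Exponential speed or excluded patterns *)

Section PatternsOrBounded.
Variable P : poset_collection.
Hypothesis Pher : hereditary_property P.


Let wide m k (mk : m <= k) (x : 'I_m + 'I_m) : 'I_k + 'I_k :=
  match x with inl i => inl (widen_ord mk i) | inr i => inr (widen_ord mk i) end.

Let wide_inj m k (mk : m <= k) : injective (wide mk).
Proof. by move=> [i|i] [j|j] //= [] /val_inj ->. Qed.

Lemma speed_or_pattern_free :
  (forall n, 4 <= n -> 2 ^ n - 1 <= speed P n) \/
  exists m, forall (V : finType) (R : rel V), realized P R -> pattern_free m R.
Proof.
have n_ge n : 4 <= n -> (1 < n) * (0 < n) by move=> n4; split; lia.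
have [/(speed_of_chains Pher)|/existsNP[m1 H1]] :=
    pselect (forall m, realized P (@chain_rel m)).
  by left.
have [/(speed_of_bicliques Pher) H|/existsNP[m2 H2]] :=
    pselect (forall m, realized P (@biclique_rel m)).
  by left.
have [/(@speed_of_stars _ Pher false) H|/existsNP[m3 H3]] :=
    pselect (forall m, realized P (@star_rel m)).
  by left=> n /n_ge n_gt; apply: H; rewrite n_gt.
have [/(@speed_of_stars _ Pher true) H|/existsNP[m4 H4]] :=
    pselect (forall m, realized P (fun x y => @star_rel m y x)).
  by left=> n /n_ge n_gt; apply: H; rewrite n_gt.
have [/(speed_of_matchings Pher) H|/existsNP[m5 H5]] :=
    pselect (forall m, realized P (@matching_rel m)).
  by left=> n /n_ge n_gt; apply: H; rewrite n_gt.
(* Each pattern embeds in its larger copies, so the sum of the five excluded sizes excludes all of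
   them at once. *)
right; pose m := m1 + m2 + m3 + m4 + m5; exists m => V R PR.
have star_mono a b : a <= b -> embeds (@star_rel a) (@star_rel b).
  move=> ab; exists (omap (wide ab)); first by apply: inj_omap; apply: wide_inj.
  by move=> [[i|i]|] [[j|j]|].
have free (I : nat -> finType) (pattern : forall m, rel (I m)) k :
    (forall m k, m <= k -> embeds (pattern m) (pattern k)) -> k <= m ->
    ~ realized P (pattern k) -> ~ embeds (pattern m) R.
  move=> mono km npk; apply: contra_not npk => emb.
  by apply: realized_embeds (mono _ _ km) _; apply: realized_embeds emb PR.
split.
- apply: (free _ chain_rel m1) => //; last by rewrite /m; lia.
  by move=> a b ab; exists (widen_ord ab) => // i j /(congr1 val)/= /val_inj.
- apply: (free _ biclique_rel m2) => //; last by rewrite /m; lia.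
  by move=> a b ab; exists (wide ab); [apply: wide_inj | move=> [i|i] [j|j]].
- by apply: (free _ star_rel m3) => //; rewrite /m; lia.
- move=> /embeds_flip emb.
  apply: (free _ (fun m x y => @star_rel m y x) m4) => //; last by rewrite /m; lia.
  by move=> a b ab; apply: embeds_flip; apply: star_mono.
- apply: (free _ matching_rel m5) => //; last by rewrite /m; lia.
  by move=> a b ab; exists (wide ab); [apply: wide_inj | move=> [i|i] [j|j]].
Qed.

End PatternsOrBounded.

(** * Twins and cores *)

(* X is a set of elements to be ignored, as if they were deleted. *)
Definition twin (V : finType) (R : rel V) (X : {set V}) (u v : V) : bool :=
  (u == v) || [&& ~~ R u v, ~~ R v u &
    [forall z, [&& z \notin X, z != u & z != v] ==> (R z u == R z v) && (R u z == R v z)]].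

(* The complement of S is a twin class; the bound on #|S| makes S unique. *)
Definition is_core (V : finType) (R : rel V) (S : {set V}) : bool :=
  (2 * #|S| < #|V|) && [forall v, (v \notin S) ==> [forall u, twin R set0 u v == (u \notin S)]].

Section Twins.
Variables (V : finType) (R : rel V) (X : {set V}).

Lemma twinP u v : reflect
  (u = v \/ [/\ R u v = false, R v u = false &
     forall z, z \notin X -> z != u -> z != v -> R z u = R z v /\ R u z = R v z])
  (twin R X u v).
Proof.
apply: (iffP orP) => [[/eqP|/and3P[/negPf uv /negPf vu /forallP H]]|[->|[uv vu H]]];
  [by left| |by left|].
  right; split=> // z Xz zu zv.
  by have := H z; rewrite Xz zu zv => /andP[/eqP-> /eqP->].
right; rewrite uv vu; apply/forallP => z; apply/implyP => /and3P[Xz zu zv].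
by case: (H z Xz zu zv) => -> ->; rewrite !eqxx.
Qed.

Lemma twin_refl u : twin R X u u.
Proof. by apply/twinP; left. Qed.

Lemma twin_sym u v : twin R X u v -> twin R X v u.
Proof.
move=> /twinP[->|[uv vu H]]; apply/twinP; [by left | right; split=> // z Xz zu zv].
by case: (H z Xz zv zu).
Qed.

Lemma twin_trans v u w : u \notin X -> v \notin X -> w \notin X ->
  twin R X u v -> twin R X v w -> twin R X u w.
Proof.
move=> Xu Xv Xw /twinP[->//|[uv vu Huv]] /twinP[<-|[vw wv Hvw]].
  by apply/twinP; right.
apply/twinP; have [->|uw] := eqVneq u w; [by left | right].
have [Ewu Euw] : R w u = false /\ R u w = false.
  have [wv'|wv'] := eqVneq w v; first by rewrite wv' vu uv.
  by have [|->->] := Huv w Xw _ wv'; rewrite // eq_sym.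
split=> // z Xz zu zw; have [->|zv] := eqVneq z v; first by rewrite vu uv vw wv.
by have [-> ->] := Huv z Xz zu zv; apply: Hvw.
Qed.

End Twins.

Section Core.
Variables (V : finType) (R : rel V).

Lemma is_coreP (S : {set V}) : reflect
  (2 * #|S| < #|V| /\ forall u v, v \notin S -> twin R set0 u v = (u \notin S))
  (is_core R S).
Proof.
apply: (iffP andP) => -[szS H]; split=> //.
  by move=> u v vS; apply/eqP; move/forallP/(_ v): H; rewrite vS => /forallP.
by apply/forallP => v; apply/implyP => vS; apply/forallP => u; rewrite H.
Qed.

Lemma core_out (S : {set V}) : is_core R S -> exists v, v \notin S.
Proof.
move=> /is_coreP[szS _]; have /card_gt0P[v] : 0 < #|~: S| by have := cardsC S; lia.
by rewrite inE; exists v.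
Qed.

Lemma core_unique (S T : {set V}) : is_core R S -> is_core R T -> S = T.
Proof.
move=> /is_coreP[szS coreS] /is_coreP[szT coreT].
have /card_gt0P[v] : 0 < #|~: (S :|: T)|.
  by have := cardsC (S :|: T); have : #|S :|: T| <= _ := leq_card_setU S T; lia.
rewrite !inE negb_or => /andP[vS vT].
by apply/setP => u; apply: negb_inj; rewrite -(coreS u v) // coreT.
Qed.

Lemma core_of_class v (S : {set V}) : 2 * #|S| < #|V| -> v \notin S ->
  (forall u, twin R set0 u v = (u \notin S)) -> is_core R S.
Proof.
have set0P x : x \notin (set0 : {set V}) by rewrite inE.
move=> szS vS H; apply/is_coreP; split=> // u w wS; rewrite -H.
have wv : twin R set0 w v by rewrite H.
apply/idP/idP => tw; first exact: twin_trans tw wv.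
exact: twin_trans tw (twin_sym wv).
Qed.

Lemma core_exists (S0 : {set V}) : exceptional R S0 -> 2 * #|S0| < #|V| ->
  exists2 S : {set V}, is_core R S & S \subset S0.
Proof.
move=> [anti0 exc0] sz0.
have /card_gt0P[v] : 0 < #|~: S0| by have := cardsC S0; lia.
move=> vS0; pose S := [set u | ~~ twin R set0 u v].
have sS : S \subset S0.
  apply/subsetP => u; rewrite inE; apply: contraR => uS0; apply/twinP.
  have [->|uv] := eqVneq u v; [by left | right].
  have US0 : u \in ~: S0 by rewrite inE.
  have [Euv Evu] : R u v = false /\ R v u = false.
    by rewrite !anti0 // [v == u]eq_sym (negPf uv).
  split=> // z _ zu zv; have [zS0|zS0] := boolP (z \in S0); first exact: exc0.
  have ZS0 : z \in ~: S0 by rewrite inE.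
  by rewrite !anti0 // ![_ == z]eq_sym (negPf zu) (negPf zv).
exists S => //; apply: (@core_of_class v).
- by have := subset_leq_card sS; lia.
- by rewrite inE twin_refl.
- by move=> u; rewrite inE negbK.
Qed.

Lemma core_exceptional (S : {set V}) : reflexive R -> is_core R S -> exceptional R S.
Proof.
move=> Rr /is_coreP[szS coreS].
have tw u v : u \in ~: S -> v \in ~: S -> twin R set0 u v.
  by rewrite !inE => uS vS; rewrite coreS.
split=> [u v Su Sv|u v Su Sv z zS].
  have [->|uv] := eqVneq u v; first by rewrite Rr.
  by case/twinP: (tw u v Su Sv) uv => [->|[-> _ _]]; rewrite ?eqxx.
have zu : z != u by apply: contraTneq Su => <-; rewrite inE zS.
have zv : z != v by apply: contraTneq Sv => <-; rewrite inE zS.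
case/twinP: (tw u v Su Sv) => [->//|[_ _]].
by apply; rewrite ?inE.
Qed.

End Core.

(** Equal cardinalities make [f] hit all of [S], so only clones are lost. A lost clone cannot
    separate [f u] from [f v]: it is a twin of [f v], hence incomparable to [f u] as soon as [f v]
    is. *)
Lemma core_pull (V W : finType) (R : rel W) (f : V -> W) (S : {set W}) (T : {set V}) :
  reflexive R -> injective f -> (forall x, (f x \in S) = (x \in T)) -> #|S| = #|T| ->
  2 * #|T| < #|V| -> is_core R S -> is_core (fun x y => R (f x) (f y)) T.
Proof.
move=> Rr f_inj fST cardST szT coreS; have [anti exc] := core_exceptional Rr coreS.
have /is_coreP[szS tw] := coreS; apply/is_coreP; split=> // u v vT.
have fTS : f @: T = S.
  apply/eqP; rewrite eqEcard card_imset // cardST leqnn andbT.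
  by apply/subsetP => _ /imsetP[x xT ->]; rewrite fST.
have vS : f v \notin S by rewrite fST.
have FT x : x \notin T -> f x \in ~: S by rewrite inE fST.
rewrite -fST -(tw (f u) (f v)) //; apply/idP/idP => /twinP[E|[Euv Evu H]]; apply/twinP.
- by left; rewrite E.
- right; split=> // z _ zu zv; have [zS|zS] := boolP (z \in S).
    have /imsetP[x xT zE] : z \in f @: T by rewrite fTS.
    rewrite zE !(inj_eq f_inj) in zu zv *.
    by apply: H; rewrite ?inE.
  have /twinP[vz|[Evz Ezv Hvz]] : twin R set0 z (f v) by rewrite tw.
    by rewrite vz eqxx in zv.
  have uv : f u != f v by apply: contraFneq Euv => ->; apply: Rr.
  have [|||E1 E2] := Hvz (f u); rewrite ?inE //; first by rewrite eq_sym.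
  by rewrite E1 Euv Evz E2 Evu Ezv.
- by left; apply: f_inj.
- by right; split=> // z _ zu zv; apply: H; rewrite ?inE ?(inj_eq f_inj).
Qed.

Lemma injection_with_preimage (V W : finType) (S : {set V}) (T : {set W}) :
  #|S| = #|T| -> #|V| <= #|W| ->
  exists2 f : V -> W, injective f & forall x, (f x \in T) = (x \in S).
Proof.
move=> cardST cardVW; case: (pickP {: W}) => [w0 _|W0]; last first.
  have V0 : #|V| = 0 by have := eq_card0 W0; rewrite /= in cardVW *; lia.
  have noV (x : V) : False by have := card0_eq V0 x; rewrite inE.
  by exists (fun x => False_rect _ (noV x)) => x; case: (noV x).
(* Both types are listed with the distinguished set first, and elements are matched by their
   index. *)
pose s := enum S ++ enum (~: S); pose t := enum T ++ enum (~: T).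
have size_s : size s = #|V| by rewrite size_cat -!cardE cardsC.
have size_t : size t = #|W| by rewrite size_cat -!cardE cardsC.
have uniq_t : uniq t.
  rewrite cat_uniq !enum_uniq andbT /=; apply/hasPn => x; rewrite mem_enum inE => xT.
  by rewrite mem_enum.
have in_s x : x \in s by rewrite mem_cat !mem_enum inE orbN.
have lt_t x : index x s < size t by rewrite size_t (leq_trans _ cardVW) // -size_s index_mem.
exists (fun x => nth w0 t (index x s)) => [x y /eqP|x].
  by rewrite nth_uniq // => /eqP/(index_inj x); apply.
have -> : (x \in S) = (index x s < #|S|).
  rewrite /s index_cat mem_enum; case: ifP => xS; first by rewrite cardE index_mem mem_enum xS.
  by rewrite -cardE ltnNge leq_addr.
rewrite /t nth_cat -cardE cardST; case: ltnP => xT.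
  by rewrite -mem_enum mem_nth // -cardE.
apply/negbTE; rewrite -in_setC -mem_enum mem_nth //.
have := lt_t x; rewrite /t size_cat -!cardE; lia.
Qed.

Lemma core_transport (V W : finType) (R : rel W) (S : {set W}) (T : {set V}) :
  is_order R -> is_core R S -> #|S| = #|T| -> #|V| <= #|W| -> 2 * #|T| < #|V| ->
  exists2 R' : rel V, embeds R' R & is_core R' T.
Proof.
move=> [Rr _ _] coreS cardST cardVW szT.
have [f f_inj fST] := injection_with_preimage (esym cardST) cardVW.
by exists (fun x y => R (f x) (f y)); [exists f | apply: core_pull coreS].
Qed.

(** * Deleting a core element *)

Section Deletion.
Variables (V : finType) (R : rel V) (S : {set V}) (v : V).
Hypotheses (ordR : is_order R) (coreS : is_core R S) (vS : v \notin S).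

(* The elements of the core that become twins of the clones once z is deleted. *)
Definition collapse z := [set u in S | (u != z) && twin R [set z] u v].

Let coreE u : twin R set0 u v = (u \notin S).
Proof. by have /is_coreP[_ ->] := coreS. Qed.

(** An element of the core that becomes a twin of [v] once [z] is gone must have been told apart
    from [v] by [z] itself. *)
Lemma collapseP z u : z \in S -> u \in collapse z ->
  [/\ u \in S, u != z, R u v = false, R v u = false &
   [/\ forall y, y != z -> y != u -> y != v -> R y u = R y v /\ R u y = R v y &
   R z u != R z v \/ R u z != R v z]].
Proof.
move=> zS; rewrite inE => /and3P[uS uz /twinP[uv|[Euv Evu H]]].
  by move: vS; rewrite -uv uS.
split=> //; split=> [y yz|]; first by apply: H; rewrite inE.
have [zu|zu] := eqVneq (R z u) (R z v); [right | by left].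
apply: contraTneq uS => uz'; rewrite -coreE; apply/twinP; right; split=> // y _ yu yv.
by have [->//|yz] := eqVneq y z; apply: H; rewrite ?inE.
Qed.

(** Clones stay clones, so the core loses [z] and whatever joins them. The size bound survives
    because the core shrinks by at least one while the ground set shrinks by exactly one. *)
Lemma core_delete z : z \in S ->
  is_core (fun x y : {x | x != z} => R (val x) (val y)) [set x | val x \in S :\: collapse z].
Proof.
move=> zS; have vz : v != z by apply: contraNneq vS => ->.
have szV : #|{: {x | x != z}}| = #|V|.-1 by rewrite card_sig cardC1.
have szS : #|[set x : {x | x != z} | val x \in S :\: collapse z]| <= #|S|.-1.
  rewrite -(card_imset _ val_inj) [#|S|](cardsD1 z) zS /=; apply: subset_leq_card.
  by apply/subsetP => _ /imsetP[x + ->]; rewrite !inE => /andP[_ ->]; rewrite (valP x).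
apply: (@core_of_class _ _ (exist _ v vz)).
- have /is_coreP[szSV _] := coreS; rewrite szV.
  have : 0 < #|S| by apply/card_gt0P; exists z.
  by move=> S_gt0; apply: leq_ltn_trans (leq_mul (leqnn 2) szS) _; lia.
- by rewrite !inE (negPf vS) andbF.
- move=> u; have -> : (u \notin [set x : {x | x != z} | val x \in S :\: collapse z]) =
      (val u \notin S) || (val u \in collapse z) by rewrite in_set in_setD negb_and negbK orbC.
  rewrite !inE (valP u) /=.
  have -> : twin (fun x y : {x | x != z} => R (val x) (val y)) set0 u (exist _ v vz) =
      twin R [set z] (val u) v.
    apply/twinP/twinP => -[E|[Euv Evu H]].
    + by left; rewrite E.
    + right; split=> // y; rewrite inE => yz yu yv.
      by apply: (H (exist _ y yz)); rewrite ?inE // -val_eqE.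
    + by left; apply: val_inj.
    + right; split=> // y _; rewrite -!val_eqE => yu yv.
      by apply: H; rewrite // inE (valP y).
  case: (boolP (val u \in S)) => //= uS; apply/twinP.
  have := coreE (val u); rewrite uS => /twinP[->|[Euv Evu H]]; [by left | right].
  by split=> // y _; apply: H; rewrite inE.
Qed.

Lemma card_core_delete z : z \in S ->
  #|[set x : {x | x != z} | val x \in S :\: collapse z]| = #|S|.-1 - #|collapse z|.
Proof.
move=> zS; rewrite -(card_imset _ val_inj).
have -> : val @: [set x : {x | x != z} | val x \in S :\: collapse z] = S :\ z :\: collapse z.
  apply/setP => x; rewrite !in_setD !in_set1; apply/imsetP/idP => [[y + ->]|/and3P[xC xz xS]].
    by rewrite in_set in_setD => /andP[-> ->]; rewrite (valP y).
  by exists (exist _ x xz) => //; rewrite in_set in_setD xC xS.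
rewrite cardsD (cardsD1 z S) zS /= (setIidPr _) //.
by apply/subsetP => x; rewrite !inE => /and3P[-> ->].
Qed.

(* In the second case the whole core is an induced matching; only one of its
   edges is recorded. *)
Lemma deletion_dichotomy : S != set0 ->
  (exists2 z, z \in S & collapse z = set0) \/
  exists z z', [/\ z \in S, collapse z = [set z'], z' \in S, z != z' & R z z' || R z' z].
Proof.
have [Rr Ra Rt] := ordR.
case/set0Pn => z zS; have [/existsP[w /andP[wS /eqP wC]]|nex] :=
    boolP [exists w, (w \in S) && (collapse w == set0)].
  by left; exists w.
right; have ne w : w \in S -> exists u, u \in collapse w.
  move=> wS; apply/set0Pn; apply: contraNneq nex => wC.
  by apply/existsP; exists w; rewrite wS wC eqxx.
(* If y collapses when x is deleted, then every w != x incomparable to v is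
   incomparable to y, so y cannot be what distinguishes w from v. *)
have back x y w : x \in S -> y \in collapse x -> w \in collapse y -> w = x.
  move=> xS yx wy; have [yS ynx Eyv Evy [Hy _]] := collapseP xS yx.
  have [wS wny Ewv Evw [_ Dw]] := collapseP yS wy.
  have [//|wx] := eqVneq w x; have wv : w != v by apply: contraNneq vS => <-.
  have [E1 E2] := Hy w wx wny wv.
  by case: Dw; rewrite ?E1 ?E2 ?Eyv ?Evy ?Ewv ?Evw eqxx.
have [z' z'z] := ne z zS; have [z'S z'nz Ez'v Evz' [Hz' Dz']] := collapseP zS z'z.
have [w wz'] := ne z' z'S; have wz := back z z' w zS z'z wz'; rewrite {w}wz in wz'.
have [_ _ Ezv Evz _] := collapseP z'S wz'.
exists z, z'; split=> //; last 2 first.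
- by rewrite eq_sym.
(* [z] separates [z'] from [v] and is itself incomparable to [v], so it must be comparable to
   [z']. *)
- by case: Dz'; rewrite ?Ezv ?Evz; case: (R _ _) => //; rewrite orbT.
apply/setP => w; rewrite inE; apply/idP/eqP => [wz|->//].
exact: back z' z w z'S wz' wz.
Qed.

End Deletion.

(** * Counting by cores *)

Lemma nonincreasing_eventually_constant (u : nat -> nat) n0 :
  (forall m n, n0 <= m -> m <= n -> u n <= u m) ->
  exists n1 c, n0 <= n1 /\ forall n, n1 <= n -> u n = c.
Proof.
move=> noninc; have [k] := ubnP (u n0); elim: k n0 noninc => // k IHk n0 noninc u_le.
have [const|] := pselect (forall n, n0 <= n -> u n = u n0).
  by exists n0, (u n0).
move=> /existsNP[n /not_implyP[n0n /eqP un]].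
have [||n1 [c [nn1 Hc]]] := IHk n.
- by move=> a b na; apply: noninc; apply: leq_trans na.
- by have := noninc _ _ (leqnn n0) n0n; lia.
by exists n1, c; split; [apply: leq_trans nn1 | ].
Qed.

Lemma leq_bin_predn n k : 2 * k.+1 < n -> 'C(n, k) <= 'C(n, k.+1).
Proof.
move=> kn; rewrite -(leq_pmul2l (ltn0Sn k)) mul_bin_left leq_mul2r.
by apply/orP; right; lia.
Qed.

Lemma leq_bin_n n k : 0 < k < n -> n <= 'C(n, k).
Proof.
elim: n k => [|n IHn] k; first by rewrite ltn0 andbF.
case: k => [//|k]; rewrite !ltnS /= => kn; rewrite binS.
have [<-|kn'] := eqVneq k.+1 n; first by rewrite binn binSn.
have := IHn k.+1; have : 0 < 'C(n, k) by rewrite bin_gt0; lia.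
lia.
Qed.

Section Speed.
Variable P : poset_collection.
Hypothesis Pher : hereditary_property P.

Definition core_count n (S : {set 'I_n}) : nat :=
  #|[set r in labelled_members P n | is_core (pair_rel r) S]|.

Definition initial n i : {set 'I_n} := [set j : 'I_n | j < i].

(** An initial segment can represent all cores of size [i], because the count depends on the core
    only through its size. *)
Definition core_size_count n i : nat := core_count (initial n i).

Lemma card_initial n i : i <= n -> #|initial n i| = i.
Proof.
move=> le_in; have -> : initial n i = [set widen_ord le_in k | k : 'I_i].
  apply/setP => k; rewrite inE; apply/idP/imsetP => [lt_k|[l _ ->]]; last by rewrite /= ltn_ord.
  by exists (Ordinal lt_k) => //; apply: val_inj.
by rewrite card_imset ?card_ord // => k l /(congr1 val)/= /val_inj.
Qed.

Lemma member_order n (r : {set 'I_n * 'I_n}) :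
  r \in labelled_members P n -> is_order (pair_rel r).
Proof. by move=> /(labelled_membersP Pher)/realized_order. Qed.

(** Pulling back along an injection that covers [T] keeps the core and at least one clone, and these
    determine the poset. Applied in both directions with [m = n], this also shows that only the size
    of the core matters. *)
Lemma leq_core_count m n (S : {set 'I_m}) (T : {set 'I_n}) :
  #|S| = #|T| -> m <= n -> 2 * #|S| < m -> core_count T <= core_count S.
Proof.
move=> cardST le_mn szS.
have [f f_inj fTS] : exists2 f : 'I_m -> 'I_n, injective f & forall x, (f x \in T) = (x \in S).
  by apply: injection_with_preimage; rewrite ?card_ord.
pose pull (r : {set 'I_n * 'I_n}) := relset (fun x y => pair_rel r (f x) (f y)).
have fST : f @: S = T.
  apply/eqP; rewrite eqEcard card_imset // cardST leqnn andbT.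
  by apply/subsetP => _ /imsetP[x xT ->]; rewrite fTS.
have /card_gt0P[v] : 0 < #|~: S| by have := cardsC S; rewrite card_ord; lia.
rewrite inE -fTS => vT.
have pull_inj : {in [set r in labelled_members P n | is_core (pair_rel r) T] &, injective pull}.
  (* Every element outside the core may be replaced by the clone [f v], except when two such
     elements are compared with each other. *)
  have char r : r \in labelled_members P n -> is_core (pair_rel r) T -> forall x y,
      pair_rel r x y = if (x \notin T) && (y \notin T) then x == y
        else pair_rel r (if x \in T then x else f v) (if y \in T then y else f v).
    move=> /member_order[Rr _ _] /(core_exceptional Rr)[anti exc] x y.
    have vTC : f v \in ~: T by rewrite inE.
    have [xT|xT] := boolP (x \in T); have [yT|yT] //= := boolP (y \in T).
    - by case: (exc y (f v) _ _ x xT); rewrite ?inE.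
    - by case: (exc x (f v) _ _ y yT); rewrite ?inE.
    - by apply: anti; rewrite inE.
  move=> r s; rewrite in_set => /andP[rP rT]; rewrite in_set  => /andP[sP sT] rs.
  have rsf x y : pair_rel r (f x) (f y) = pair_rel s (f x) (f y).
    have := pair_relset (fun x y => pair_rel r (f x) (f y)) x y.
    by rewrite -[relset _]/(pull r) rs pair_relset.
  have inf x : exists x', (if x \in T then x else f v) = f x'.
    by case: ifP => [|_]; [rewrite -fST => /imsetP[x' _ ->]; exists x' | exists v].
  apply/setP => -[x y]; rewrite -[LHS]/(pair_rel r x y) -[RHS]/(pair_rel s x y).
  rewrite (char r rP rT x y) (char s sP sT x y); case: ifP => // _.
  by have [x' ->] := inf x; have [y' ->] := inf y.
rewrite /core_count -(card_in_imset pull_inj) subset_leq_card //.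
apply/subsetP => _ /imsetP[r + ->]; rewrite in_set => /andP[rP rT].
have [Rr _ _] := member_order rP.
have real_r : realized P (fun x y => pair_rel r (f x) (f y)).
  by move/(labelled_membersP Pher): rP; apply: realized_embeds; exists f.
rewrite in_set relset_members //=.
have := core_pull Rr f_inj fTS (esym cardST); rewrite card_ord => /(_ szS rT).
suff -> : pair_rel (pull r) = (fun x y => pair_rel r (f x) (f y)) by [].
by apply: funext => x; apply: funext => y; apply: pair_relset.
Qed.

Lemma core_size_countE n (S : {set 'I_n}) :
  2 * #|S| < n -> core_count S = core_size_count n #|S|.
Proof.
move=> szS; have sz_init : #|initial n #|S| | = #|S| by apply: card_initial; lia.
by apply/eqP; rewrite eqn_leq !leq_core_count ?sz_init.
Qed.

Lemma core_count_sum n K : 2 * K < n ->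
  \sum_(i < K.+1) 'C(n, i) * core_size_count n i =
  #|[set r in labelled_members P n |
      [exists S : {set 'I_n}, (#|S| <= K) && is_core (pair_rel r) S]]|.
Proof.
move=> Kn; rewrite -sum1_card.
pose h (r : {set 'I_n * 'I_n}) := odflt set0 [pick S | is_core (pair_rel r) S].
have hE r (S : {set 'I_n}) : is_core (pair_rel r) S -> h r = S.
  move=> rS; rewrite /h; case: pickP => [T rT|/(_ S)]; last by rewrite rS.
  exact: core_unique rT rS.
pose Q (S : {set 'I_n}) := #|S| <= K.
rewrite (partition_big h Q); last first.
  by move=> r; rewrite in_set => /andP[_ /existsP[S /andP[szS /hE->]]].
(* The default value of [inord] is never reached, since [Q] bounds the size by [K]. *)
rewrite (partition_big (fun S : {set 'I_n} => inord #|S| : 'I_K.+1) xpredT) //=.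
apply: eq_bigr => i _.
have -> : 'C(n, i) = #|[set S : {set 'I_n} | #|S| == i]| by rewrite card_draws card_ord.
rewrite -sum_nat_const; apply: eq_big => [S|S].
  rewrite in_set /Q; have [szS|szS] := leqP #|S| K => /=.
    by rewrite -val_eqE /= inordK.
  by apply/negP => /eqP szi; have := ltn_ord i; rewrite -szi ltnS leqNgt szS.
rewrite in_set => /eqP szS; have szi := ltn_ord i.
rewrite -szS -core_size_countE; last by lia.
rewrite /core_count -sum1_card; apply: eq_bigl => r; rewrite !in_set.
apply/idP/idP => [/andP[-> rS]|/andP[/andP[-> /existsP[T /andP[_ rT]]] /eqP hr]].
  rewrite (hE _ _ rS) eqxx andbT; apply/existsP; exists S; rewrite rS andbT szS -ltnS; exact: szi.
by rewrite -hr (hE _ _ rT) rT.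
Qed.

Lemma leq_core_sum_speed n K : 2 * K < n ->
  \sum_(i < K.+1) 'C(n, i) * core_size_count n i <= speed P n.
Proof.
move=> /core_count_sum ->; apply: subset_leq_card.
by apply/subsetP => r; rewrite in_set => /andP[].
Qed.

Lemma core_count_gt0 (V : finType) (R : rel V) (S : {set V}) n (T : {set 'I_n}) :
  realized P R -> is_core R S -> #|S| = #|T| -> n <= #|V| -> 2 * #|T| < n -> 0 < core_count T.
Proof.
move=> PR coreS cardST nV szT.
have [||R' emb coreR'] := core_transport (realized_order PR) coreS cardST; rewrite ?card_ord //.
have PR' := realized_embeds emb PR.
apply/card_gt0P; exists (relset R'); rewrite in_set relset_members //=.
suff -> : pair_rel (relset R') = R' by [].
by apply: funext => x; apply: funext => y; apply: pair_relset.
Qed.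

Lemma core_count_gt1 (V : finType) (R : rel V) (S : {set V}) z z' n (T : {set 'I_n}) :
  realized P R -> is_core R S -> z \in S -> z' \in S -> z != z' -> R z z' || R z' z ->
  #|S| = #|T| -> n <= #|V| -> 2 * #|T| < n -> 1 < core_count T.
Proof.
move=> PR coreS zS z'S zz' Rzz' cardST nV szT; have [Rr Ra _] := realized_order PR.
have [f f_inj fTS] : exists2 f : 'I_n -> V, injective f & forall x, (f x \in S) = (x \in T).
  by apply: injection_with_preimage; rewrite ?card_ord.
have fST : f @: T = S.
  apply/eqP; rewrite eqEcard card_imset // cardST leqnn andbT.
  by apply/subsetP => _ /imsetP[x xT ->]; rewrite fTS.
have /imsetP[x xT zE] : z \in f @: T by rewrite fST.
have /imsetP[y yT z'E] : z' \in f @: T by rewrite fST.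
have xy : x != y by apply: contraNneq zz' => xy; rewrite zE z'E xy.
pose R1 : rel 'I_n := fun i j => R (f i) (f j).
pose R2 : rel 'I_n := fun i j => R1 (tperm x y i) (tperm x y j).
have emb1 : embeds R1 R by exists f.
have emb2 : embeds R2 R1 by exists (tperm x y) => //; apply: perm_inj.
have core1 : is_core R1 T by apply: core_pull coreS; rewrite ?card_ord.
have core2 : is_core R2 T.
  apply: core_pull core1; rewrite ?card_ord //; first by move=> i; apply: Rr.
    exact: perm_inj.
  by move=> i; case: tpermP => // ->; rewrite xT yT.
(* If swapping the pair left the order unchanged, its elements would be comparable in both
   directions. *)
have R12 : relset R1 != relset R2.
  apply: contra_neq xy => E; apply: f_inj; apply: Ra; rewrite -zE -z'E.
  have : R1 x y = R2 x y by rewrite -(pair_relset R1) E pair_relset.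
  by rewrite /R2 tpermL tpermR /R1 -zE -z'E => E12; move: Rzz'; rewrite -E12 orbb => ->.
have <- : #|[set relset R1; relset R2]| = 2 by rewrite cards2 R12.
have relsetK (Q : rel 'I_n) : pair_rel (relset Q) = Q.
  by apply: funext => i; apply: funext => j; apply: pair_relset.
have PR1 := realized_embeds emb1 PR; have PR2 := realized_embeds emb2 PR1.
apply: subset_leq_card; apply/subsetP => r /set2P[]->.
  by rewrite in_set relset_members // relsetK.
by rewrite in_set relset_members // relsetK.
Qed.

(** As the counts do not increase with [n], this amounts to cores of size [i] occurring in
    arbitrarily large realized posets. *)
Definition good i := forall n, 2 * i < n -> 0 < core_size_count n i.

Lemma core_count_witness n (S : {set 'I_n}) : 0 < core_count S ->
  exists2 r : {set 'I_n * 'I_n}, r \in labelled_members P n & is_core (pair_rel r) S.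
Proof. by case/card_gt0P => r; rewrite in_set => /andP[rP rS]; exists r. Qed.

Lemma not_good_vanishes i : ~ good i -> exists n0, forall (V : finType) (R : rel V) (S : {set V}),
  realized P R -> is_core R S -> n0 <= #|V| -> #|S| <> i.
Proof.
move=> /existsNP[n /not_implyP[szn /negP]]; rewrite -eqn0Ngt => /eqP count0.
exists n => V R S PR coreS nV szS.
have sz_init : #|initial n i| = i by apply: card_initial; lia.
have := @core_count_gt0 V R S n (initial n i) PR coreS.
by rewrite sz_init szS -/(core_size_count n i) count0 => /(_ erefl nV szn).
Qed.

Lemma good_of_large i : (forall N, exists (V : finType) (R : rel V) (S : {set V}),
  [/\ N <= #|V|, realized P R, is_core R S & #|S| = i]) -> good i.
Proof.
move=> large; apply: contrapT => /not_good_vanishes[n0 H].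
by have [V [R [S [nV PR coreS szS]]]] := large n0; apply: (H V R S).
Qed.

(** If [i.-1] is not good, no large poset has a core of that size, so in large posets deleting any
    core element must collapse another one. The resulting pair shows [1 < i], its joint
    disappearance makes [i.-2] good, and swapping it doubles the count. *)
Lemma good_descent i : good i -> 0 < i -> ~ good i.-1 ->
  [/\ 1 < i, good i.-2 & forall n, 2 * i < n -> 1 < core_size_count n i].
Proof.
move=> gi i_gt0 /not_good_vanishes[n0 small].
have matched N : exists n (r : {set 'I_n * 'I_n}) (S : {set 'I_n}) z z' v,
    [/\ N < n, r \in labelled_members P n, is_core (pair_rel r) S, #|S| = i & v \notin S] /\
    [/\ z \in S, collapse (pair_rel r) S v z = [set z'], z' \in S, z != z' &
      pair_rel r z z' || pair_rel r z' z].
  (* The successor leaves at least [n0] elements after [z] is deleted. *)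
  pose n := (N + n0 + 2 * i).+1; pose S := initial n i.
  have szS : #|S| = i by apply: card_initial; lia.
  have [r rP rS] : exists2 r : {set 'I_n * 'I_n},
      r \in labelled_members P n & is_core (pair_rel r) S.
    by apply: core_count_witness; apply: gi; lia.
  have ordr := member_order rP; have [v vS] := core_out rS.
  have Sn0 : S != set0 by rewrite -card_gt0 szS.
  case: (deletion_dichotomy ordr rS vS Sn0) => [[z zS zC]|[z [z' H]]]; last first.
    by exists n, r, S, z, z', v; split=> //; split=> //; lia.
  have [] := small _ _ _ _ (core_delete rS vS zS).
  - move/(labelled_membersP Pher): rP; apply: realized_embeds.
    by exists val => //; apply: val_inj.
  - by rewrite card_sig cardC1 card_ord /=; lia.
  - by rewrite card_core_delete // zC cards0 subn0 szS.
split.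
- have [n [r [S [z [z' [v [[_ rP rS szS vS] [zS zC z'S zz' _]]]]]]]] := matched 0.
  rewrite -szS; have <- : #|[set z; z']| = 2 by rewrite cards2 zz'.
  by apply: subset_leq_card; apply/subsetP => x; rewrite !inE => /orP[]/eqP->.
- apply: good_of_large => N.
  have [n [r [S [z [z' [v [[Nn rP rS szS vS] [zS zC z'S zz' _]]]]]]]] := matched N.
  exists {x | x != z}, (fun x y => pair_rel r (val x) (val y)),
    [set x | val x \in S :\: collapse (pair_rel r) S v z]; split.
  + by rewrite card_sig cardC1 card_ord; lia.
  + by move/(labelled_membersP Pher): rP; apply: realized_embeds; exists val => //; apply: val_inj.
  + exact: core_delete.
  + by rewrite card_core_delete // zC cards1 szS; lia.
- move=> n szn; have [N [r [S [z [z' [v [[Nn rP rS szS vS] [zS zC z'S zz' Rzz']]]]]]]] := matched n.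
  have sz_init : #|initial n i| = i by apply: card_initial; lia.
  move/(labelled_membersP Pher): rP => rP.
  by apply: (core_count_gt1 rP rS zS z'S zz' Rzz'); rewrite ?sz_init ?card_ord // ltnW.
Qed.

Lemma good_binomial_sum K n : good K -> 2 * K < n ->
  \sum_(i < K.+1) 'C(n, i) <= \sum_(i < K.+1) 'C(n, i) * core_size_count n i.
Proof.
(* Strong induction, since the descent skips one size when [K.-1] is not good. *)
have [k] := ubnP K; elim: k K => // k IHk K Kk gK Kn.
have gK_ge := gK n Kn; case: K => [|K] in Kk gK Kn gK_ge *.
  by rewrite !big_ord_recr !big_ord0 /= !add0n leq_pmulr.
have [gK'|ngK'] := pselect (good K).
  rewrite big_ord_recr [leqRHS]big_ord_recr /=; apply: leq_add; last by rewrite leq_pmulr.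
  by apply: IHk => //; lia.
have [K_gt0 gK2 gt1] := good_descent gK (ltn0Sn K) ngK'.
case: K => [//|K] in Kk gK Kn gK_ge ngK' K_gt0 gK2 gt1 *.
have sum3 (F : nat -> nat) :
    \sum_(i < K.+3) F i = \sum_(i < K.+1) F i + (F K.+1 + F K.+2).
  by rewrite 2!big_ord_recr addnA.
rewrite (sum3 (fun i => 'C(n, i))) (sum3 (fun i => 'C(n, i) * core_size_count n i)).
apply: leq_add; first by apply: IHk => //; lia.
apply: leq_trans (leq_add (leq_bin_predn Kn) (leqnn _)) _.
rewrite addnn -muln2; apply: leq_trans (leq_addl _ _).
by rewrite leq_mul2l gt1 ?orbT.
Qed.

End Speed.

(** * The linear lower bound *)

Definition nonmaximal (V : finType) (R : rel V) : {set V} :=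
  [set x | [exists y, (y != x) && R x y]].

Lemma nonmaximal_proper (V : finType) (R : rel V) (x0 : V) :
  is_order R -> exists x, x \notin nonmaximal R.
Proof.
move=> [Rr Ra Rt].
have [x _ xmax] := arg_maxnP (fun x => #|[set z | R z x]|) (erefl : predT x0).
exists x; rewrite inE; apply/existsP => -[y /andP[yx Rxy]].
have := xmax y isT; apply/negP; rewrite -ltnNge; apply: proper_card.
apply/properP; split; first by apply/subsetP => z; rewrite !inE => /Rt; apply.
by exists y; rewrite inE ?Rr //; apply: contra yx => Ryx; apply/eqP/Ra; rewrite Ryx.
Qed.

Section NonAntichain.
Variable P : poset_collection.
Hypothesis Pher : hereditary_property P.

(** The set of nonmaximal elements has size strictly between [0] and [n]. Relabelling moves it onto
    any set of that size, which gives at least [n] different posets, and the antichain is one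
    more. *)
Lemma leq_speed_of_nonantichain n (R : rel 'I_n) x y :
  realized P (fun i j : 'I_n => i == j) -> realized P R -> x != y -> R x y ->
  n + 1 <= speed P n.
Proof.
move=> Panti PR xy Rxy; have ordR := realized_order PR.
pose A := nonmaximal R.
have A_gt0 : 0 < #|A|.
  by apply/card_gt0P; exists x; rewrite inE; apply/existsP; exists y; rewrite eq_sym xy.
have A_lt : #|A| < n.
  have [z zA] := nonmaximal_proper x ordR.
  have : A \subset [set~ z] by apply/subsetP => i Ai; rewrite !inE; apply: contraNneq zA => <-.
  move/subset_leq_card; rewrite cardsC1 card_ord; have := ltn_ord z; lia.
have /choice[F HF] : forall T : {set 'I_n}, exists R' : rel 'I_n,
    #|T| = #|A| -> realized P R' /\ nonmaximal R' = T.
  move=> T; have [cardT|/eqP neT] := eqVneq #|T| #|A|; last by exists R => /neT.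
  have [f f_inj fA] : exists2 f : 'I_n -> 'I_n, injective f & forall i, (f i \in A) = (i \in T).
    by apply: injection_with_preimage.
  exists (fun i j => R (f i) (f j)) => _; split.
    by apply: realized_embeds PR; exists f.
  have [g fg gf] := injF_bij f_inj.
  apply/setP => i; rewrite -fA !inE; apply/existsP/existsP => -[j /andP[ij Rij]].
    by exists (f j); rewrite (inj_eq f_inj) ij.
  by exists (g j); rewrite gf -(inj_eq f_inj) gf ij.
pose X : {set {set 'I_n}} := set0 |: [set T : {set 'I_n} | #|T| == #|A|].
have cardX : #|X| = 'C(n, #|A|) + 1.
  by rewrite cardsU1 card_draws card_ord inE cards0 eq_sym -[_ == _]negbK -lt0n A_gt0 addnC.
apply: leq_trans (_ : #|X| <= _); first by rewrite cardX leq_add2r leq_bin_n ?A_gt0.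
pose G (T : {set 'I_n}) : rel 'I_n := if T == set0 then (fun i j => i == j) else F T.
have GE T : T \in X -> realized P (G T) /\ nonmaximal (G T) = T.
  rewrite /G in_setU1; have [->|T0] := eqVneq T set0; last by rewrite inE => /eqP/HF.
  move=> _; split=> //; apply/setP => i; rewrite !inE; apply/existsP => -[j /andP[ji /eqP ij]].
  by rewrite ij eqxx in ji.
apply: (@leq_card_speed _ Pher _ X _ G) => [T /GE[]//|S T /GE[_ SE] /GE[_ TE] ST].
by rewrite -SE -TE; apply/setP => i; rewrite !inE; apply: eq_existsb => j; rewrite ST.
Qed.

(** In an antichain all elements are twins, so a nonempty core forces a comparable pair, and the
    poset can be cut down to [n] elements that include this pair. *)
Lemma leq_speed_of_core (V : finType) (R : rel V) (S : {set V}) n :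
  realized P (fun i j : 'I_n => i == j) -> realized P R -> is_core R S -> S != set0 ->
  n <= #|V| -> 1 < n -> n + 1 <= speed P n.
Proof.
move=> Panti PR coreS /set0Pn[z zS] nV n1; have [Rr _ _] := realized_order PR.
have [v vS] := core_out coreS.
have [x [y xy Rxy]] : exists x, exists2 y, x != y & R x y.
  apply: contrapT => noxy; have REq a b : a != b -> R a b = false.
    by move=> ab; apply/negP => Rab; apply: noxy; exists a, b.
  have /is_coreP[_ tw] := coreS; have := tw z v vS; rewrite zS => /negP; apply.
  have zv : z != v by apply: contraNneq vS => <-.
  apply/twinP; right; split; [by rewrite REq| by rewrite REq // eq_sym | move=> w _ wz wv].
  by rewrite !REq // eq_sym.
have sz : #|initial n 2| = #|[set x; y]| by rewrite card_initial // cards2 xy.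
have [f f_inj fT] : exists2 f : 'I_n -> V, injective f &
    forall i, (f i \in [set x; y]) = (i \in initial n 2).
  by apply: injection_with_preimage; rewrite ?card_ord.
have fE : f @: initial n 2 = [set x; y].
  apply/eqP; rewrite eqEcard card_imset // sz leqnn andbT.
  by apply/subsetP => _ /imsetP[i iT ->]; rewrite fT.
have /imsetP[i _ xE] : x \in f @: initial n 2 by rewrite fE !inE eqxx.
have /imsetP[j _ yE] : y \in f @: initial n 2 by rewrite fE !inE eqxx orbT.
apply: (@leq_speed_of_nonantichain n (fun a b => R (f a) (f b)) i j) => //.
- by apply: realized_embeds PR; exists f.
- by apply: contraNneq xy => ij; rewrite xE yE ij.
- by rewrite -xE -yE.
Qed.

End NonAntichain.

(** * The polynomial case *)

Section Alternatives.
Variable P : poset_collection.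
Hypothesis Pher : hereditary_property P.
Variable M : nat.
Hypothesis bounded : forall (V : finType) (R : rel V), realized P R ->
  exists2 S : {set V}, #|S| <= M & exceptional R S.

Lemma realized_antichain n : realized P (fun i j : 'I_n => i == j).
Proof.
have [V [R [szV PR]]] := realized_large Pher (n + M).
have [S szS [anti _]] := bounded PR.
have [|f f_inj fS] := @ord_inj_in_set _ (~: S) n; first by have := cardsC S; lia.
by apply: realized_embeds PR; exists f => // i j; rewrite anti // inj_eq.
Qed.

Lemma speed_core_sum n : 2 * M < n ->
  speed P n = \sum_(i < M.+1) 'C(n, i) * core_size_count P n i.
Proof.
move=> Mn; rewrite core_count_sum // /speed; congr #|pred_of_set _|.
apply/setP => r; rewrite in_set; apply/esym/andb_idr => /(labelled_membersP Pher) Pr.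
have [S0 szS0 /core_exists] := bounded Pr; rewrite card_ord => /(_ _)[|S coreS sS]; first by lia.
by apply/existsP; exists S; rewrite coreS (leq_trans (subset_leq_card sS)).
Qed.

Lemma core_size_count0 n : 0 < n -> core_size_count P n 0 = 1.
Proof.
move=> n0; have -> : core_size_count P n 0 = core_count P (set0 : {set 'I_n}).
  by rewrite /core_size_count; congr core_count; apply/setP => i; rewrite !inE ltn0.
apply: (@eq_card1 _ (relset (fun i j : 'I_n => i == j))) => r; rewrite in_set [RHS]inE /=.
apply/andP/eqP => [[rP corer]|->].
  have [Rr _ _] := member_order Pher rP; have [anti _] := core_exceptional Rr corer.
  apply/setP => -[i j]; rewrite -[LHS]/(pair_rel r i j) anti ?inE //.
split; first by apply: relset_members => //; apply: realized_antichain.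
apply/is_coreP; rewrite cards0 card_ord; split=> // u v _; rewrite inE; apply/twinP.
have [->|uv] := eqVneq u v; [by left | right].
split=> [||z _ zu zv]; rewrite !pair_relset ?(negPf uv) //.
  by rewrite eq_sym (negPf uv).
by rewrite ![_ == z]eq_sym (negPf zu) (negPf zv).
Qed.

Lemma core_size_count_noninc i m n : 2 * i < m -> m <= n ->
  core_size_count P n i <= core_size_count P m i.
Proof. by move=> im mn; apply: leq_core_count => //; rewrite !card_initial //; lia. Qed.

Lemma speed_alternatives :
  (exists N : nat, 0 < N /\ forall n : nat, N <= n -> speed P n = 1)
  \/ ((exists K : nat,
         [/\ 0 < K,
             exists a : 'I_K.+1 -> int,
               a ord_max <> 0%R /\
               exists n0 : nat, forall n : nat, n0 <= n ->
                 (speed P n)%:Z%R = (\sum_(i < K.+1) a i * 'C(n, i)%:Z)%R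
           & forall n : nat, 2 * K + 1 <= n ->
               \sum_(i < K.+1) 'C(n, i) <= speed P n])
      /\ (forall n : nat, 3 <= n -> n + 1 <= speed P n)).
Proof.
have /choice[N /choice[c Nc]] : forall i, exists n1 c, 2 * i < n1 /\
    forall n, n1 <= n -> core_size_count P n i = c.
  move=> i; have [|n1 [c [in1 H]]] :=
      @nonincreasing_eventually_constant (fun n => core_size_count P n i) (2 * i).+1.
    by move=> m n im mn; apply: core_size_count_noninc.
  by exists n1, c.
have c0 : c 0 = 1.
  by have [N0 H0] := Nc 0; rewrite -(H0 (N 0)) ?leqnn // core_size_count0.
have goodc i : 0 < c i -> good P i.
  move=> ci n szn; have [Ni H] := Nc i.
  apply: leq_trans (core_size_count_noninc szn (leq_maxl n (N i))).
  by rewrite H ?leq_maxr.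
(* [K] is the largest core size whose eventual count is positive; size [0] qualifies because the
   antichain is the only poset with empty core. [K = 0] is the case of constant speed. *)
have [K cK Kmax] :=
  @arg_maxnP _ (ord0 : 'I_M.+1) (fun i => 0 < c i) (fun i => val i) (eq_leq (esym c0)).
pose n0 := (2 * M).+1 + \max_(i < M.+1) N i.
have speedE n : n0 <= n -> speed P n = \sum_(i < K.+1) c i * 'C(n, i).
  move=> n0n; rewrite speed_core_sum; last by rewrite /n0 in n0n; lia.
  rewrite (big_ord_widen M.+1 (fun i => c i * 'C(n, i))) // [RHS]big_mkcond /=.
  apply: eq_bigr => i _; have [_ ->] := Nc i; last first.
    apply: leq_trans n0n; apply: leq_trans (leq_addl _ _).
    exact: (@leq_bigmax _ (fun i : 'I_M.+1 => N i)).
  rewrite mulnC; case: ifP => // /negbT; rewrite -leqNgt => Ki.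
  suff -> : c i = 0 by [].
  by apply/eqP; rewrite -leqn0 leqNgt; apply/negP => /Kmax /=; rewrite leqNgt Ki.
have [K0|K_gt0] := posnP K.
  left; exists n0; split=> // n /speedE ->.
  by rewrite K0 big_ord_recr big_ord0 /= c0 bin0.
right; split.
  exists K; split=> //.
    exists (fun i => Posz (c i)); split; first by apply/eqP; rewrite -lt0n.
    exists n0 => n /speedE ->; rewrite (big_morph Posz PoszD (erefl _)).
    by apply: eq_bigr => i _; rewrite PoszM.
  move=> n Kn; apply: leq_trans (leq_core_sum_speed Pher _); last by rewrite addn1 in Kn; exact: Kn.
  by apply: good_binomial_sum => //; [apply: goodc | rewrite addn1 in Kn].
(* The binomial bound starts only at [2 * K + 1], so small [n] are reached by cutting down a large
   poset with a core of size [K]. *)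
move=> n n3; pose m := n + (2 * K).+1.
have [|r rP coreS] := @core_count_witness P m (initial m K).
  by apply: (goodc _ cK); rewrite /m; lia.
move/(labelled_membersP Pher): rP => rP.
apply: (leq_speed_of_core Pher (realized_antichain n) rP coreS); rewrite ?card_ord.
- by rewrite -card_gt0 card_initial //; rewrite /m; lia.
- exact: leq_addr.
- by lia.
Qed.

End Alternatives.

(** * Extremal examples *)

(** Complete bipartite orders with lower side [A]. Bounding the size of [A] by [K] gives the
    binomial sums, and no restriction gives [2 ^ n - 1]. *)
Definition biclique_posets (Q : pred nat) : poset_collection :=
  fun d T => exists2 A : {set T}, Q #|A| &
    forall x y : T, (x <= y)%O = (x == y) || (x \in A) && (y \notin A).

Definition biclique_order n (A : {set 'I_n}) : {set 'I_n * 'I_n} :=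
  relset (fun i j => (i == j) || (i \in A) && (j \notin A)).

Lemma biclique_order_partial n (A : {set 'I_n}) : partial_order (biclique_order A).
Proof.
split=> [i|i j|j i k]; rewrite !pair_relset ?eqxx //.
  by case: eqVneq => [//|_] /=; case: (i \in A); rewrite ?andbF.
case: eqVneq => [->//|_] /=; case: (eqVneq j k) => [->|_] /=; first by move=> ->; rewrite orbT.
by move=> /andP[_ /negPf->].
Qed.

Section BicliquePosets.
Variable Q : pred nat.
Hypotheses (Q0 : Q 0) (Q_down : forall a b, a <= b -> Q b -> Q a).

Lemma mem_biclique_order n (A : {set 'I_n}) :
  Q #|A| -> biclique_order A \in labelled_members (biclique_posets Q) n.
Proof.
move=> QA; rewrite inE; apply/asboolP; exists (biclique_order_partial A), A => // i j.
exact: pair_relset.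
Qed.

Lemma biclique_posets_hereditary : hereditary_property (biclique_posets Q).
Proof.
split.
- move=> d d' T U [f [g fg gf] f_mono] [A QA TA]; exists (f @: A).
    by rewrite card_imset //; apply: can_inj fg.
  move=> x y; rewrite -(gf x) -(gf y) f_mono TA.
  by rewrite !(mem_imset _ _ (can_inj fg)) (inj_eq (can_inj fg)).
- move=> d T B [A QA TA]; exists [set x : induced_subposet B | val x \in A].
    apply: Q_down QA; rewrite -(card_imset _ val_inj); apply: subset_leq_card.
    by apply/subsetP => _ /imsetP[x + ->]; rewrite inE.
  by move=> x y; rewrite -[LHS]/(val x <= val y)%O TA !inE.
- move=> m; exists labelled_poset_display,
    (labelled_poset (biclique_order_partial (set0 : {set 'I_m}))).
  split; first by rewrite -[leqRHS]/#|'I_m| card_ord.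
  by exists set0 => [|i j]; [rewrite cards0 | exact: pair_relset].
Qed.

(** Unless it is the full set, the lower side is recovered as the set of nonmaximal elements. The
    full set repeats the antichain, which [Q0] already provides through the empty set. *)
Lemma speed_biclique_posets n : 0 < n ->
  speed (biclique_posets Q) n = #|[set A : {set 'I_n} | Q #|A| & A != setT]|.
Proof.
move=> n0; set X := [set A | _].
have strict (A : {set 'I_n}) : A != setT ->
    A = [set i | [exists j, (j != i) && pair_rel (biclique_order A) i j]].
  rewrite -subTset => /subsetPn[j _ jA]; apply/setP => i; rewrite inE.
  apply/idP/existsP => [iA|[k /andP[ki]]].
    exists j; rewrite pair_relset iA jA orbT andbT.
    by apply: contraNneq jA => ->.
  by rewrite pair_relset eq_sym (negPf ki) => /andP[].
have inj : {in X &, injective (@biclique_order n)}.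
  by move=> A B; rewrite !inE => /andP[_ AT] /andP[_ BT] AB; rewrite (strict A) // AB -strict.
rewrite -(card_in_imset inj); congr #|pred_of_set _|; apply/setP => r.
apply/idP/imsetP => [|[A + ->]]; last by rewrite inE => /andP[QA _]; apply: mem_biclique_order.
rewrite inE => /asboolP[ord_r [A QA rA]].
have {}rA i j : pair_rel r i j = (i == j) || (i \in A) && (j \notin A) := rA i j.
have rE : r = biclique_order A by apply/setP => -[i j]; rewrite -[LHS]/(pair_rel r i j) rA inE.
have [AT|AT] := eqVneq A setT; last by exists A; rewrite ?inE ?QA.
exists set0; last by rewrite rE AT; apply/setP => -[i j]; rewrite !inE.
by rewrite inE cards0 Q0 eq_sym -card_gt0 cardsT card_ord n0.
Qed.

End BicliquePosets.

Lemma sum_binomial_card (T : finType) K :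
  \sum_(i < K.+1) 'C(#|T|, i) = #|[set A : {set T} | #|A| <= K]|.
Proof.
rewrite -sum1_card (partition_big (fun A : {set T} => inord #|A| : 'I_K.+1) xpredT) //=.
apply: eq_bigr => i _; rewrite -card_draws -sum1_card; apply: eq_bigl => A.
rewrite !in_set; have [szA|szA] := leqP #|A| K => /=; first by rewrite -val_eqE /= inordK.
by apply/negP => /eqP szi; have := ltn_ord i; rewrite -szi ltnS leqNgt szA.
Qed.

Lemma speed_bounded_bicliques K n : K < n ->
  speed (biclique_posets (fun a => a <= K)) n = \sum_(i < K.+1) 'C(n, i).
Proof.
move=> Kn; rewrite speed_biclique_posets //; last by apply: leq_ltn_trans Kn.
have := sum_binomial_card 'I_n K; rewrite card_ord => ->; congr #|pred_of_set _|.
(* As [K < n], the size bound already excludes the full set. *)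
apply/setP => A; rewrite !inE; apply: andb_idr; apply: contraTneq => ->.
by rewrite cardsT card_ord -ltnNge.
Qed.

Theorem theorem2 :
  (forall P : poset_collection, hereditary_property P ->
     (exists N : nat, 0 < N /\ forall n : nat, N <= n -> speed P n = 1)
     \/
     ((exists K : nat,
         [/\ 0 < K,
             exists a : 'I_K.+1 -> int,
               a ord_max <> 0%R /\
               exists n0 : nat, forall n : nat, n0 <= n ->
                 (speed P n)%:Z%R = (\sum_(i < K.+1) a i * 'C(n, i)%:Z)%R
           & forall n : nat, 2 * K + 1 <= n ->
               \sum_(i < K.+1) 'C(n, i) <= speed P n])
      /\ (forall n : nat, 3 <= n -> n + 1 <= speed P n))
     \/
     (forall n : nat, 6 <= n -> 2 ^ n - 1 <= speed P n))
  /\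
  [/\ forall K : nat, 0 < K ->
        exists P : poset_collection, hereditary_property P /\
          forall n : nat, 2 * K + 1 <= n ->
            speed P n = \sum_(i < K.+1) 'C(n, i),
      exists P : poset_collection, hereditary_property P /\
        forall n : nat, 3 <= n -> speed P n = n + 1
    & exists P : poset_collection, hereditary_property P /\
        forall n : nat, 6 <= n -> speed P n = 2 ^ n - 1].
Proof.
have bounded_hereditary K : hereditary_property (biclique_posets (fun a => a <= K)).
  by apply: biclique_posets_hereditary => // a b ab; apply: leq_trans.
split; last split.
- move=> P Pher; have [large|[m free]] := speed_or_pattern_free Pher.
    by right; right=> n n6; apply: large; apply: leq_trans n6.
  have [M bounded] := pattern_free_exceptional m.
  have [|a|b] := @speed_alternatives P Pher M; last by right; left.
  + by move=> V R PR; apply: bounded; [apply: realized_order PR | apply: free].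
  + by left.
- move=> K K_gt0; exists (biclique_posets (fun a => a <= K)); split=> // n Kn.
  by apply: speed_bounded_bicliques; lia.
- exists (biclique_posets (fun a => a <= 1)); split=> // n n3.
  rewrite speed_bounded_bicliques; last by lia.
  by rewrite !big_ord_recr big_ord0 /= bin0 bin1 addnC.
- exists (biclique_posets xpredT); split; first exact: biclique_posets_hereditary.
  move=> n n6; rewrite speed_biclique_posets //; last by lia.
  have -> : [set A : {set 'I_n} | true & A != setT] = [set~ setT].
    by apply/setP => A; rewrite !inE.
  by rewrite cardsC1 -cardsT -powersetT card_powerset cardsT card_ord subn1.
Qed.
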